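(* Let $n\ge 1$ be an integer and let $P_1,P_2,Q_1,Q_2,I_1,I_2,J_1,J_2\subseteq[n]$ be nonempty with $|P_k|=|Q_k|$ and $|I_k|=|J_k|$ for $k=1,2$, and $|P_1|+|P_2|=|I_1|+|I_2|=n$. Define $$R_1:=P_1\cup(2n+1-Q_2),\quad R_2:=P_2\cup(2n+1-Q_1),\quad K_1:=I_1\cup(2n+1-J_2),\quad K_2:=I_2\cup(2n+1-J_1),$$ and $M:=(R_1\setminus R_2)\cup(R_2\setminus R_1)$. Then statement (4) below is equivalent to each of (1), (2), (3): (1) For all $n\times n$ totally nonnegative matrices $A$, $\det A(P_1|Q_1)\det A(P_2|Q_2)\le\det A(I_1|J_1)\det A(I_2|J_2)$. (2) For all $2n\times 2n$ totally nonnegative matrices $B$, $\det B(R_1|R_1)\det B(R_2|R_2)\le\det B(K_1|K_1)\det B(K_2|K_2)$. (3) The multisets $R_1\cup R_2$ and $K_1\cup K_2$ are equal, and for all even contiguous $S\subseteq M$, $\max\{|S\cap R_1|,|S\cap R_2|\}\ge\max\{|S\cap K_1|,|S\cap K_2|\}$. (4) The multisets $R_1\cup R_2$ and $K_1\cup K_2$ are equal, and for all integers $k\ge 1$ and all consecutive integer pairs $(u_1,v_1),\dots,(u_k,v_k)$ in $[2n]$: with $\mathrm S_{(U_0,V_0)}$ the identity operation and $\mathrm S_{(U_j,V_j)}:=\mathrm S_{(u_j,v_j)}\circ\mathrm S_{(U_{j-1},V_{j-1})}$ for $1\le j\le k$, if $$\mathrm S_{(U_j,V_j)}\big((R_1,R_2)\big)\ne\mathrm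 S_{(U_{j-1},V_{j-1})}\big((R_1,R_2)\big)\quad\text{for all } j\in\{1,\dots,k\},$$ then $$\mathrm S_{(U_j,V_j)}\big((K_1,K_2)\big)\ne\mathrm S_{(U_{j-1},V_{j-1})}\big((K_1,K_2)\big)\quad\text{for all } j\in\{1,\dots,k\}.$$
   Context: $[m]=\{1,\dots,m\}$. For an integer $l$ and a set $X$ of integers, $l-X:=\{l-x:x\in X\}$. Equality of the multisets $R_1\cup R_2$ and $K_1\cup K_2$ means that every integer lies in the same number of the sets $R_1,R_2$ as of the sets $K_1,K_2$. For $M=\{m_1<\cdots<m_t\}$, a subset $S\subseteq M$ is contiguous in $M$ if $S=\{m_s:s\in L\}$ for some interval of integers $L\subseteq[t]$; it is even if $|S|$ is even. A consecutive integer pair in $[2n]$ is a pair $(u,v)$ with $u,v\in[2n]$ and $|u-v|=1$. For $X\subseteq[2n]$, $X(u,v):=(X\setminus\{u\})\cup\{v\}$ if $u\in X$, $v\notin X$, and $X(u,v):=X$ otherwise; the set operation $\mathrm S_{(u,v)}$ acts on ordered pairs of sets by $\mathrm S_{(u,v)}((X_1,X_2)):=(X_1(u,v),X_2(u,v))$. $A(X|Y)$ is the submatrix of $A$ with row indices in $X$ and column indices in $Y$ (increasing order); the empty determinant is $1$. A real matrix is totally nonnegative (TN) if the determinant of each of its square submatrices is $\ge 0$. *)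

(* Defs.v *)
From mathcomp Require Import all_boot all_order all_algebra reals.

Set Implicit Arguments.
Unset Strict Implicit.
Unset Printing Implicit Defensive.

Import Order.TTheory GRing.Theory Num.Theory.
Local Open Scope ring_scope.

(* The set [m] = {1, ..., m} is represented by 'I_m, with i : 'I_m standing   *)
(* for the integer i + 1.                                                     *)

(* enum_val lists a set of ordinals in increasing order. *)
Definition submx_on (R : realType) (m : nat) (A : 'M[R]_m) (X Y : {set 'I_m})
    (eXY : #|X| = #|Y|) : 'M[R]_#|X| :=
  \matrix_(i, j) A (enum_val i) (enum_val (cast_ord eXY j)).

Definition minor (R : realType) (m : nat) (A : 'M[R]_m) (X Y : {set 'I_m})
    (eXY : #|X| = #|Y|) : R :=
  \det (submx_on A eXY).

Definition totally_nonnegative (R : realType) (m : nat) (A : 'M[R]_m) : Prop :=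
  forall (X Y : {set 'I_m}) (eXY : #|X| = #|Y|), 0 <= minor A eXY.

(* P U (2n+1-Q), for P and Q subsets of [n]: since i : 'I_n stands for i + 1, *)
(* the map rev_ord on 'I_(n + n) stands for x |-> 2n + 1 - x on [2n].         *)
Definition join_rev (n : nat) (P Q : {set 'I_n}) : {set 'I_(n + n)} :=
  [set lshift n i | i in P] :|: [set rev_ord (lshift n i) | i in Q].

Definition eq_multiset_union (m : nat) (R1 R2 K1 K2 : {set 'I_m}) : Prop :=
  forall x : 'I_m,
    ((x \in R1) + (x \in R2))%N = ((x \in K1) + (x \in K2))%N.

(* The intervals of indices are half-open, so that S may be empty. *)
Definition contiguous_in (m : nat) (M S : {set 'I_m}) : Prop :=
  exists a b : nat, S = [set enum_val s | s : 'I_#|M| & (a <= s < b)%N].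

Definition consecutive (m : nat) (u v : 'I_m) : Prop :=
  `|(u : nat)%:Z - (v : nat)%:Z| = 1.

Definition replace_elt (m : nat) (u v : 'I_m) (X : {set 'I_m}) : {set 'I_m} :=
  if (u \in X) && (v \notin X) then (X :\ u) :|: [set v] else X.

Definition set_op (m : nat) (u v : 'I_m) (X : {set 'I_m} * {set 'I_m}) :
    {set 'I_m} * {set 'I_m} :=
  (replace_elt u v X.1, replace_elt u v X.2).

(* The composition of the first j operations, those of (u 1, v 1), ...,       *)
(* (u j, v j); u 0 and v 0 are not used.                                      *)
Fixpoint set_ops (m : nat) (u v : nat -> 'I_m) (j : nat)
    (X : {set 'I_m} * {set 'I_m}) : {set 'I_m} * {set 'I_m} :=
  if j is i.+1 then set_op (u j) (v j) (set_ops u v i X) else X.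

Definition minor_ineq (R : realType) (n : nat)
    (P1 P2 Q1 Q2 I1 I2 J1 J2 : {set 'I_n})
    (eP1 : #|P1| = #|Q1|) (eP2 : #|P2| = #|Q2|)
    (eI1 : #|I1| = #|J1|) (eI2 : #|I2| = #|J2|) : Prop :=
  forall A : 'M[R]_n, totally_nonnegative A ->
    minor A eP1 * minor A eP2 <= minor A eI1 * minor A eI2.

Definition principal_minor_ineq (R : realType) (m : nat)
    (R1 R2 K1 K2 : {set 'I_m}) : Prop :=
  forall B : 'M[R]_m, totally_nonnegative B ->
    minor B (erefl #|R1|) * minor B (erefl #|R2|)
      <= minor B (erefl #|K1|) * minor B (erefl #|K2|).

Definition even_contiguous_dominance (m : nat)
    (R1 R2 K1 K2 : {set 'I_m}) : Prop :=
  eq_multiset_union R1 R2 K1 K2 /\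
  forall S : {set 'I_m},
    contiguous_in ((R1 :\: R2) :|: (R2 :\: R1)) S -> ~~ odd #|S| ->
    (maxn #|S :&: K1| #|S :&: K2| <= maxn #|S :&: R1| #|S :&: R2|)%N.

Definition set_op_dominance (m : nat) (R1 R2 K1 K2 : {set 'I_m}) : Prop :=
  eq_multiset_union R1 R2 K1 K2 /\
  forall (k : nat) (u v : nat -> 'I_m), (1 <= k)%N ->
    (forall j : nat, (1 <= j <= k)%N -> consecutive (u j) (v j)) ->
    (forall j : nat, (1 <= j <= k)%N ->
       set_ops u v j (R1, R2) <> set_ops u v j.-1 (R1, R2)) ->
    (forall j : nat, (1 <= j <= k)%N ->
       set_ops u v j (K1, K2) <> set_ops u v j.-1 (K1, K2)).

(* Main.v *)
(* Reading a pair of sets as a word with letters 1 and 2 on the positions of  *)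
(* M, a nontrivial set operation either moves a letter past an empty or       *)
(* doubly occupied position or cancels two neighbouring distinct letters.     *)
(* Prefix sums of the word (heights) turn (3) into a condition on absolute  *)
(* height differences, which such operations inherit; conversely, cancelling  *)
(* as much as possible inside an interval shows that (4) implies (3).         *)
(* A minor of an n x n matrix is a Pluecker coordinate indexed by an n-subset *)
(* of [2n], and each set operation is realized by adding multiples of a row   *)
(* or column to a neighbouring one, or by raising the corner entry. Letting   *)
(* the multiple tend to infinity shows that (1) is inherited by set           *)
(* operations, whence (1) implies (3). Conversely, the product of two minors  *)
(* of a totally nonnegative matrix is a nonnegative combination of indicator  *)
(* functions of compatible noncrossing diagrams: this holds for the zero      *)
(* matrix, is preserved by the elementary operations, and Neville elimination *)
(* builds every totally nonnegative matrix from these. Under (3), diagrams    *)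
(* compatible with (R1, R2) are compatible with (K1, K2).                     *)
(* Finally (2) is the case of size 2n of (1), with doubled words.             *)

Require Import Defs.
From mathcomp Require Import all_boot all_order all_algebra reals.
From mathcomp Require Import fingroup perm.
From mathcomp Require Import zify ring lra.

Set Implicit Arguments.
Unset Strict Implicit.
Unset Printing Implicit Defensive.

Import Order.TTheory GRing.Theory Num.Theory.
Local Open Scope ring_scope.

(** * Set operations and heights *)

(** Read a pair X of subsets as a word: +1 at a position lying in the first set only, -1 in the
    second set only, 0 elsewhere; [height] is its prefix sum. Each of the four statements turns out
    to be equivalent to [height_dominance]: the multisets agree, and across every window where the
    height of X changes by an even amount, the height of Y changes by no more in absolute value.

    Statement (3) is this condition up to arithmetic ([even_contiguous_dominance_height]). For (4),
    a nontrivial operation alters the height at one cut only, and there it copies the height of a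
    neighbouring cut, so the condition is inherited ([height_dominance_set_op]). Conversely, take
    any relation that implies equal multisets and is inherited by nontrivial operations. Opposite
    letters of X inside a window can be brought together and cancelled; once all remaining letters
    agree, the height change of X is the number of letters, which bounds that of Y ([dom_height]).

    For (1), complementing the column set turns minors into Pluecker coordinates, on which row and
    column additions and the raising of the corner entry act through the same moves
    ([plucker_move]). Comparing leading coefficients in the parameter shows that (1) is inherited by
    moves, so [dom_height] gives necessity ([plucker_dom_height]). For sufficiency, the product of
    two coordinates is a nonnegative combination of indicators of compatibility with noncrossing
    diagrams ([cone_plucker_tn]). The two ends of an arc see equal heights of X, hence equal heights
    of Y, so compatibility passes from X to Y ([compat_dominance]). Membership in the cone is proved
    by generation: it holds for the zero matrix, survives the elementary operations by a
    Temperley-Lieb type computation ([cone_move_one]), and elimination, resting on the inequality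
    [whitney_minors], reduces every totally nonnegative matrix to the zero matrix.

    Statement (2) is an instance of (1) at size 2n: its word goes forth and then retraces itself, so
    no new heights occur ([height_dominance_doubled]). *)

Section SetOperations.
Variable m : nat.
Implicit Types (u v x y : 'I_m) (X Y : {set 'I_m} * {set 'I_m}).
Implicit Types (Z : {set 'I_m}).

Definition adjacent u v : bool := (u.+1 == v :> nat) || (v.+1 == u :> nat).

Lemma consecutiveP u v : consecutive u v <-> adjacent u v.
Proof. rewrite /consecutive /adjacent; split; lia. Qed.

Definition acts u v Z : bool := (u \in Z) && (v \notin Z).

Lemma replace_elt_acts u v Z : acts u v Z ->
  replace_elt u v Z = [set x | tperm u v x \in Z].
Proof.
rewrite /acts /replace_elt => /[dup] /andP[uZ vZ] ->; apply/setP => x.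
by rewrite !inE; case: tpermP => [->|->|/eqP/negPf-> /eqP/negPf->];
   rewrite ?eqxx ?uZ ?(negPf vZ) ?orbT ?andbF ?orbF //;
   case: eqP => // e; move: vZ; rewrite -e uZ.
Qed.

Lemma replace_elt_id u v Z : ~~ acts u v Z -> replace_elt u v Z = Z.
Proof. by rewrite /acts /replace_elt => /negPf->. Qed.

Lemma in_replace_elt u v x Z : (x \in replace_elt u v Z) =
  if acts u v Z then (x == v) || (x != u) && (x \in Z) else x \in Z.
Proof.
by rewrite /acts /replace_elt; case: ifP => // _; rewrite !inE orbC.
Qed.

Lemma replace_elt_neq u v Z : acts u v Z -> replace_elt u v Z != Z.
Proof.
move=> a; apply/eqP => /setP/(_ v); rewrite in_replace_elt a eqxx /=.
by case/andP: a => _ /negPf->.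
Qed.

Lemma card_replace_elt u v Z : #|replace_elt u v Z| = #|Z|.
Proof.
have [a|a] := boolP (acts u v Z); last by rewrite replace_elt_id.
rewrite replace_elt_acts // -[RHS](card_imset _ (@perm_inj _ (tperm u v))).
congr #|pred_of_set _|; apply/setP=> x; rewrite inE; apply/idP/imsetP => [h|].
  by exists (tperm u v x); rewrite ?tpermK.
by case=> y yZ ->; rewrite tpermK.
Qed.

Lemma set_op_neq u v X :
  set_op u v X <> X <-> acts u v X.1 || acts u v X.2.
Proof.
case: X => X1 X2; rewrite /set_op /=; split.
  move=> h; apply/negP => /negP; rewrite negb_or => /andP[a1 a2].
  by apply: h; rewrite !replace_elt_id.
by case/orP => a [e1 e2]; move: (replace_elt_neq a); rewrite ?e1 ?e2 eqxx.
Qed.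

Definition bal X x : int := (x \in X.1)%:R - (x \in X.2)%:R.
Definition height X (k : nat) : int := \sum_(x < m | (x < k)%N) bal X x.

Lemma balE X x : bal X x = (x \in X.1)%:Z - (x \in X.2)%:Z.
Proof. by rewrite /bal; case: (_ \in _); case: (_ \in _). Qed.

Lemma adjacent_neq u v : adjacent u v -> u != v.
Proof. by rewrite /adjacent -val_eqE /=; lia. Qed.

Lemma tperm_ltn u v (k : nat) x : adjacent u v -> k != maxn u v ->
  (tperm u v x < k)%N = (x < k)%N.
Proof.
rewrite /adjacent => a hk; case: tpermP => [->|->|//]; apply/idP/idP; lia.
Qed.

Lemma sum_replace_elt u v Z (k : nat) : adjacent u v -> k != maxn u v ->
  \sum_(x < m | (x < k)%N) (x \in replace_elt u v Z)%:R =
  \sum_(x < m | (x < k)%N) (x \in Z)%:R :> int.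
Proof.
move=> auv hk; have [a|a] := boolP (acts u v Z); last by rewrite replace_elt_id.
rewrite replace_elt_acts //.
rewrite [RHS](reindex_inj (@perm_inj _ (tperm u v))) /=.
by apply: eq_big => [x|x _]; rewrite ?tperm_ltn ?inE.
Qed.

(** The cut at [maxn u v] is the only one separating [u] from [v]. *)
Lemma height_set_op u v X (k : nat) : adjacent u v -> k != maxn u v ->
  height (set_op u v X) k = height X k.
Proof.
move=> a hk; rewrite /height /bal !big_split /= !sumrN.
by rewrite !sum_replace_elt.
Qed.

Lemma heightS X x : height X x.+1 = height X x + bal X x.
Proof.
rewrite /height (bigD1 x) ?ltnSn //= addrC; congr (_ + _).
by apply: eq_bigl => y; rewrite -val_eqE /=; lia.
Qed.

Definition multeq X Y := eq_multiset_union X.1 X.2 Y.1 Y.2.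

Lemma multeq_bal0 X Y x : multeq X Y -> (bal Y x == 0) = (bal X x == 0).
Proof.
move=> /(_ x); rewrite !balE.
by case: (_ \in _); case: (_ \in _); case: (_ \in _); case: (_ \in _).
Qed.

(** The multiplicities at [u] and [v] determine how many of the two sets a nontrivial operation
    changes: both for multiplicities 2 and 0, exactly one otherwise. *)
Lemma multeq_set_op u v X Y : multeq X Y -> u != v ->
  set_op u v X <> X -> set_op u v Y <> Y ->
  multeq (set_op u v X) (set_op u v Y).
Proof.
move=> e nuv /set_op_neq hX /set_op_neq hY x.
rewrite /set_op /= !in_replace_elt.
move: (e u) (e v) (e x) hX hY nuv; rewrite /acts.
have [->|nxu] := eqVneq x u.
  case: (boolP (u == v)) => // _.
  by do 4 case: (u \in _); do 4 case: (v \in _).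
have [->|nxv] := eqVneq x v.
  by do 4 case: (u \in _); do 4 case: (v \in _).
by rewrite /= !if_same.
Qed.

End SetOperations.

(** * Cancelling opposite letters inside a window *)

Section Cancellation.
Variable m : nat.
Implicit Types (u v x y z : 'I_m) (X Y : {set 'I_m} * {set 'I_m}).

Lemma bal_set_op_other u v X z : z != u -> z != v ->
  bal (set_op u v X) z = bal X z.
Proof.
move=> /negPf zu /negPf zv.
by rewrite /bal /set_op /= !in_replace_elt zu zv /= !if_same.
Qed.

(** An empty [o] receives the letter at [x]; a doubly occupied [o] hands over to [x] the copy that
    [x] lacks. In both cases the letter travels to [o]. *)
Lemma bal_swap X x o : adjacent x o -> bal X x != 0 -> bal X o = 0 ->
  exists u v, [/\ (u, v) = (x, o) \/ (u, v) = (o, x),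
    set_op u v X <> X & forall z, bal (set_op u v X) z = bal X (tperm x o z)].
Proof.
move=> a; rewrite !balE => bx bo; have nxo := adjacent_neq a.
have [o1|o1] := boolP (o \in X.1); [exists o, x|exists x, o]; split;
  [by right| | |by left| | ].
all: try (apply/set_op_neq; move: bx bo o1; rewrite /acts;
  by do 2 case: (x \in _); do 2 case: (o \in _)).
all: move=> z; case: (tpermP x o z) => [->|->|/eqP zx /eqP zo];
  last by rewrite bal_set_op_other.
all: rewrite !balE /set_op /= !in_replace_elt /acts ?eqxx ?(eq_sym o x) ?(negPf nxo).
all: move: bx bo o1; by do 2 case: (x \in _); do 2 case: (o \in _).
Qed.

Lemma bal_cancel X x y : adjacent x y -> bal X x != 0 ->
  bal X x + bal X y = 0 ->
  set_op x y X <> X /\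
  forall z, bal (set_op x y X) z =
            if (z == x) || (z == y) then 0 else bal X z.
Proof.
move=> a; rewrite !balE => bx bo; have nxo := adjacent_neq a.
split.
  apply/set_op_neq; move: bx bo; rewrite /acts.
  by do 2 case: (x \in _); do 2 case: (y \in _).
move=> z; have [->|zx] := eqVneq z x; last have [->|zy] := eqVneq z y => /=;
  last by rewrite bal_set_op_other // balE.
all: rewrite balE /set_op /= !in_replace_elt /acts ?eqxx ?(negPf nxo).
all: move: bx bo; by do 2 case: (x \in _); do 2 case: (y \in _).
Qed.

Definition singles (a b : nat) X : nat :=
  #|[set z : 'I_m | (a <= z < b)%N & bal X z != 0]|.

Variables (n : nat) (dom : {set 'I_m} * {set 'I_m} ->
                           {set 'I_m} * {set 'I_m} -> Prop).
Hypothesis dom_multeq : forall X Y, dom X Y -> multeq X Y.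
(* A move from position n down to position n-1 is not required: for matrices  *)
(* it would amount to a rational change of normalization.                     *)
Hypothesis dom_set_op : forall u v X Y, dom X Y -> adjacent u v ->
  ((u < n) == (v < n))%N || (u < v)%N -> set_op u v X <> X ->
  set_op u v Y <> Y /\ dom (set_op u v X) (set_op u v Y).

(** Induction on the distance of two opposite letters, bounded by [d]. A letter between them is
    opposite to one of the two, giving a closer pair; otherwise one letter slides towards the other.
    Every move alters a cut strictly between [a] and [b] only, so the heights at both ends survive,
    for X and for Y. *)
Lemma cancel_pair d (a b : nat) X Y x y : dom X Y ->
  (y < x + d)%N -> (a <= x)%N -> (x < y)%N -> (y < b)%N ->
  bal X x != 0 -> bal X x + bal X y = 0 ->
  exists X' Y', [/\ dom X' Y',
    height X' a = height X a /\ height X' b = height X b,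
    height Y' a = height Y a /\ height Y' b = height Y b &
    (singles a b X' < singles a b X)%N].
Proof.
elim: d X Y x y => [|d IH] X Y x y dXY yd ax xy yb bx bxy; first lia.
have [/existsP[z /and3P[xz zy bz]]|none] :=
  boolP [exists z : 'I_m, [&& (x < z)%N, (z < y)%N & bal X z != 0]].
  have [bxz|bzy] : bal X x + bal X z = 0 \/ bal X z + bal X y = 0.
  - move: bxy bx bz; rewrite !balE.
    by do 2 case: (x \in _); do 2 case: (y \in _); do 2 case: (z \in _); auto.
  - by apply: (IH X Y x z) => //; lia.
  - by apply: (IH X Y z y) => //; lia.
have gap z : (x < z)%N -> (z < y)%N -> bal X z = 0.
  move=> xz zy; apply/eqP; move: none.
  by rewrite negb_exists => /forallP/(_ z); rewrite xz zy /= negbK.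
have [yx|yx] := eqVneq (y : nat) x.+1.
  have axy : adjacent x y by rewrite /adjacent yx eqxx.
  have [nX balX'] := bal_cancel axy bx bxy.
  have [//|nY dXY'] := dom_set_op dXY axy _ nX; first by rewrite xy orbT.
  exists (set_op x y X), (set_op x y Y).
  split=> //; try by rewrite !height_set_op //; lia.
  apply: proper_card; apply/properP; split.
    apply/subsetP => z; rewrite !inE balX'.
    by case: ifP => _ //; rewrite eqxx andbF.
  exists x; first by rewrite !inE bx andbT; lia.
  by rewrite !inE balX' !eqxx andbF.
have singles_swap (p q : 'I_m) X' : (a <= p < b)%N -> (a <= q < b)%N ->
    (forall z, bal X' z = bal X (tperm p q z)) ->
    singles a b X' = singles a b X.
  move=> hp hq h; rewrite /singles.
  have ht z : (a <= tperm p q z < b)%N = (a <= z < b)%N.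
    by case: tpermP => [->|->|//]; rewrite hp hq.
  rewrite -[LHS](card_imset _ (@perm_inj _ (tperm p q))).
  congr #|pred_of_set _|; apply/setP=> z; rewrite inE; apply/imsetP/idP.
    by case=> w; rewrite inE h => hw ->; rewrite ht.
  by move=> hz; exists (tperm p q z); rewrite ?tpermK // inE h tpermK ht.
(* If [x.+1] is still below [n], the left letter moves right within the lower half; otherwise [y.-1]
   is at least [n] and the right letter moves left within the upper half. So only the final
   cancellation, which goes upwards, can cross the middle. *)
have [xn|xn] := ltnP x.+1 n.
  have om : (x.+1 < m)%N by have := ltn_ord y; lia.
  pose o := Ordinal om.
  have axo : adjacent x o by rewrite /adjacent eqxx.
  have bo : bal X o = 0 by apply: gap => /=; lia.
  have [u [v [uv nX balX']]] := bal_swap axo bx bo.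
  have auv : adjacent u v.
    by move: axo; rewrite /adjacent; case: uv => [[-> ->]|[-> ->]]; lia.
  have guv : (((u < n) == (v < n)) || (u < v))%N.
    by case: uv => [[-> ->]|[-> ->]] /=; lia.
  have muv : maxn u v = x.+1 by case: uv => [[-> ->]|[-> ->]] /=; lia.
  have [nY dXY'] := dom_set_op dXY auv guv nX.
  have [||||||X' [Y' [d' hX' hY' s']]] := IH _ _ o y dXY'.
  - by rewrite /=; lia.
  - by rewrite /=; lia.
  - by rewrite /=; lia.
  - by [].
  - by rewrite balX' tpermR.
  - rewrite !balX' tpermR tpermD //; by apply/eqP => /(congr1 val) /=; lia.
  exists X', Y'; move: hX' hY' s'; rewrite !height_set_op ?muv //; try lia.
  have ss : singles a b (set_op u v X) = singles a b X.
  by apply: (@singles_swap x o) => //=; lia.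
by rewrite ss => hX' hY' s'; split.
have om : (y.-1 < m)%N by have := ltn_ord y; lia.
pose o := Ordinal om.
have ayo : adjacent y o by rewrite /adjacent /=; lia.
have bo : bal X o = 0 by apply: gap => /=; lia.
have by0 : bal X y != 0.
  by move: bxy bx => /eqP; rewrite addr_eq0 => /eqP->; rewrite oppr_eq0.
have [u [v [uv nX balX']]] := bal_swap ayo by0 bo.
have auv : adjacent u v.
  by move: ayo; rewrite /adjacent; case: uv => [[-> ->]|[-> ->]]; lia.
have guv : (((u < n) == (v < n)) || (u < v))%N.
  by case: uv => [[-> ->]|[-> ->]] /=; lia.
have muv : maxn u v = y by case: uv => [[-> ->]|[-> ->]] /=; lia.
have [nY dXY'] := dom_set_op dXY auv guv nX.
have xo : tperm y o x = x.
  rewrite tpermD //; apply/eqP => /(congr1 val) /=; lia.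
have [||||||X' [Y' [d' hX' hY' s']]] := IH _ _ x o dXY'.
- by rewrite /=; lia.
- by [].
- by rewrite /=; lia.
- by rewrite /=; lia.
- by rewrite balX' xo.
- by rewrite !balX' xo tpermR.
exists X', Y'; move: hX' hY' s'; rewrite !height_set_op ?muv //; try lia.
have ss : singles a b (set_op u v X) = singles a b X.
  by apply: (@singles_swap y o) => //=; lia.
by rewrite ss => hX' hY' s'; split.
Qed.

Lemma heightB X (a b : nat) : (a <= b)%N ->
  height X b - height X a = \sum_(x < m | (a <= x < b)%N) bal X x.
Proof.
move=> ab; rewrite /height (bigID (fun x : 'I_m => (x < a)%N)) /= addrC.
rewrite [X in _ + X - _](_ : _ = \sum_(x < m | (x < a)%N) bal X x); last first.
  by apply: eq_bigl => x; lia.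
by rewrite addrK; apply: eq_bigl => x; lia.
Qed.

Lemma norm_heightB X (a b : nat) : (a <= b)%N ->
  `|height X b - height X a| <= (singles a b X)%:Z.
Proof.
move=> ab; rewrite heightB //; apply: le_trans (ler_norm_sum _ _ _) _.
rewrite /singles -sum1_card -natz natr_sum.
rewrite big_mkcond [X in _ <= X]big_mkcond /=.
apply: ler_sum => x _; rewrite !inE balE.
by case: (a <= x < b)%N => //=; do 2 case: (x \in _).
Qed.

(** Induction on the number of letters of X in the window. When no opposite pair is left, the change
    of height of X is this number up to sign; by equality of multisets Y has letters at the same
    positions, so its change is no larger. *)
Lemma dom_height X Y (a b : nat) : dom X Y ->
  `|height Y b - height Y a| <= `|height X b - height X a|.
Proof.
wlog ab : a b / (a <= b)%N => [hw|].
  by case: (leqP a b) => [|/ltnW] /hw // h /h; rewrite distrC (distrC (height X a)).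
have [k] := ubnP (singles a b X); elim: k X Y => // k IH X Y sk dXY.
have [/existsP[x /existsP[y /and5P[ax xy yb bx /eqP bxy]]]|none] :=
  boolP [exists x : 'I_m, [exists y : 'I_m,
   [&& (a <= x)%N, (x < y)%N, (y < b)%N, bal X x != 0 & bal X x + bal X y == 0]]].
  have [X' [Y' [d' [<- <-] [<- <-] s']]] :=
    cancel_pair dXY (leq_addl x y.+1 : (y < x + y.+1)%N) ax xy yb bx bxy.
  by apply: IH => //; lia.
suff -> : `|height X b - height X a| = (singles a b X)%:Z.
  apply: le_trans (norm_heightB _ ab) _; rewrite lez_nat /singles.
  rewrite (eq_card (B := [set z : 'I_m | (a <= z < b)%N & bal X z != 0])) //.
  by move=> z; rewrite !inE (multeq_bal0 _ (dom_multeq dXY)).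
have same x y : (a <= x < b)%N -> (a <= y < b)%N -> bal X x != 0 -> bal X y != 0 ->
    bal X x = bal X y.
  wlog xy : x y / (x < y)%N => [hw|] hx hy bx by0.
    case: (ltngtP x y) => [|/hw h|/val_inj->//]; first by move/hw; apply.
    by rewrite h.
  move: none; rewrite negb_exists => /forallP/(_ x).
  rewrite negb_exists => /forallP/(_ y).
  rewrite xy bx; case/andP: hx => -> _; case/andP: hy => _ -> /=.
  by move: bx by0; rewrite !balE; do 2 case: (x \in _); do 2 case: (y \in _).
rewrite heightB //.
have [/existsP[x /andP[hx bx]]|no] :=
  boolP [exists x : 'I_m, (a <= x < b)%N && (bal X x != 0)].
  have -> : \sum_(z < m | (a <= z < b)%N) bal X z = bal X x *+ singles a b X.
    rewrite /singles -sumr_const big_mkcond [RHS]big_mkcond /=.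
    apply: eq_bigr => z _; rewrite inE; case: ifP => //= hz.
    by have [//|bz] := eqVneq (bal X z) 0; apply: same.
  rewrite normrMn (_ : `|bal X x| = 1) ?natz //.
  by move: bx; rewrite balE; do 2 case: (x \in _).
rewrite big1 ?normr0; last first.
  move=> z hz; apply/eqP; move: no; rewrite negb_exists => /forallP/(_ z).
  by rewrite hz /= negbK.
apply/esym/eqP; rewrite eqz_nat cards_eq0; apply/eqP/setP => z.
rewrite !inE; apply/negbTE; move: no; rewrite negb_exists => /forallP/(_ z).
by rewrite -andbA.
Qed.

End Cancellation.

(** * Height dominance and sequences of set operations *)

Section HeightDominance.
Variable m : nat.
Implicit Types (u v x y z : 'I_m) (X Y : {set 'I_m} * {set 'I_m}).

(* This is condition (3): on a subset of M the maximum is determined by the    *)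
(* difference of the two cardinalities, since their sum is fixed.             *)
Definition height_dominance X Y : Prop := multeq X Y /\
  forall a b : nat, ~~ odd `|height X b - height X a|%N ->
    `|height Y b - height Y a| <= `|height X b - height X a|.

Lemma height_adjacent X u v : adjacent u v ->
  height X (maxn u v).+1 = height X (minn u v) + (bal X u + bal X v).
Proof.
rewrite /adjacent => /orP[] /eqP uv.
  rewrite (_ : maxn u v = v); last lia.
  rewrite (_ : minn u v = u); last lia.
  by rewrite heightS -uv heightS -addrA.
rewrite (_ : maxn u v = u); last lia.
rewrite (_ : minn u v = v); last lia.
by rewrite heightS -uv heightS -addrA [in RHS]addrC (addrC (bal X v)) addrC.
Qed.

Lemma bal_set_op0 X u v : u != v -> set_op u v X <> X ->
  bal (set_op u v X) u = 0 \/ bal (set_op u v X) v = 0.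
Proof.
move=> /negPf uv /set_op_neq; rewrite !balE /set_op /= !in_replace_elt /acts eqxx uv eqxx /=.
do 2 case: (u \in _); (do 2 case: (v \in _)) => //= _; by [left|right].
Qed.

Lemma height_set_op_max X u v : adjacent u v ->
  (bal (set_op u v X) (if (u < v)%N then u else v) = 0 ->
     height (set_op u v X) (maxn u v) = height X (minn u v)) /\
  (bal (set_op u v X) (if (u < v)%N then v else u) = 0 ->
     height (set_op u v X) (maxn u v) = height X (maxn u v).+1).
Proof.
move=> a; set X' := set_op u v X.
have lo : height X' (minn u v) = height X (minn u v).
  by apply: height_set_op => //; move: a; rewrite /adjacent; lia.
have hi : height X' (maxn u v).+1 = height X (maxn u v).+1.
  by apply: height_set_op => //; lia.
have e1 : (minn u v).+1 = maxn u v by move: a; rewrite /adjacent; lia.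
move: lo hi e1; case: (ltnP u v) => uv lo hi e1; split=> b0.
- by rewrite -lo -e1 heightS b0 addr0.
- by rewrite -hi heightS b0 addr0.
- by rewrite -lo -e1 heightS b0 addr0.
- by rewrite -hi heightS b0 addr0.
Qed.

(** After the operation one of [u], [v] has balance 0 in X, hence also in Y. So for both words the
    new height at the altered cut equals an old height at the same neighbouring cut [w], and the new
    condition is a case of the old one. *)
Lemma height_dominance_set_op X Y u v : height_dominance X Y -> adjacent u v ->
  set_op u v X <> X ->
  set_op u v Y <> Y /\ height_dominance (set_op u v X) (set_op u v Y).
Proof.
move=> [eXY hXY] a nX; have uv := adjacent_neq a.
have nY : set_op u v Y <> Y.
  (* Multiplicities decide whether the operation acts on Y, except when both positions carry single
     letters. Then the letters of X are opposite, the height of X does not change across the pair,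
     and the even condition makes the letters of Y opposite as well. *)
  have b2 : bal X u + bal X v = 0 -> bal Y u + bal Y v = 0.
    move=> b0; have := hXY (minn u v) (maxn u v).+1.
    rewrite !height_adjacent // b0 addr0 subrr normr0 => /(_ isT).
    by rewrite normr_le0 addrAC subrr add0r => /eqP.
  move: nX b2 (eXY u) (eXY v) => /set_op_neq h1 b2 eu ev; apply/set_op_neq.
  move: h1 b2 eu ev; rewrite !balE /acts.
  do 4 case: (u \in _); (do 4 case: (v \in _)) => //=; by move=> _ /(_ erefl).
have e' := multeq_set_op eXY uv nX nY.
split=> //; split=> //.
have [w hw] : exists w, height (set_op u v X) (maxn u v) = height X w
                     /\ height (set_op u v Y) (maxn u v) = height Y w.
  have [hX1 hX2] := height_set_op_max X a; have [hY1 hY2] := height_set_op_max Y a.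
  have b0 z : bal (set_op u v X) z = 0 -> bal (set_op u v Y) z = 0.
    by move/eqP => h; apply/eqP; rewrite (multeq_bal0 _ e').
  have : bal (set_op u v X) (if (u < v)%N then u else v) = 0 \/
         bal (set_op u v X) (if (u < v)%N then v else u) = 0.
    by case: (u < v)%N; case: (bal_set_op0 uv nX); auto.
  case=> h; first by exists (minn u v); rewrite hX1 // hY1 // b0.
  by exists (maxn u v).+1; rewrite hX2 // hY2 // b0.
have hw' k : exists k', height (set_op u v X) k = height X k' /\
                        height (set_op u v Y) k = height Y k'.
  have [->|kw] := eqVneq k (maxn u v); first by exists w.
  by exists k; rewrite !height_set_op.
by move=> p q; have [p' [-> ->]] := hw' p; have [q' [-> ->]] := hw' q; apply: hXY.
Qed.

Lemma set_ops_prepend p q (u v : nat -> 'I_m) X j :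
  set_ops (fun i => if i == 1%N then p else u i.-1)
          (fun i => if i == 1%N then q else v i.-1) j.+1 X =
  set_ops u v j (set_op p q X).
Proof. by elim: j => // j IH; rewrite [LHS]/= -/(set_ops _ _ j.+1 X) IH. Qed.

Lemma height_dominance_ops X Y (u v : nat -> 'I_m) k : height_dominance X Y ->
  (forall j, (1 <= j <= k)%N -> consecutive (u j) (v j)) ->
  (forall j, (1 <= j <= k)%N -> set_ops u v j X <> set_ops u v j.-1 X) ->
  (forall j, (1 <= j <= k)%N -> set_ops u v j Y <> set_ops u v j.-1 Y) /\
  height_dominance (set_ops u v k X) (set_ops u v k Y).
Proof.
move=> hXY; elim: k => [|k IH] cons nX; first by split=> // j; lia.
have [||nY hk] := IH.
- by move=> j hj; apply: cons; lia.
- by move=> j hj; apply: nX; lia.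
have [||nYk hk'] := height_dominance_set_op hk _ (nX k.+1 _); try lia.
  by apply/consecutiveP/cons; lia.
split=> // j /andP[j1]; rewrite leq_eqVlt ltnS => /predU1P[->//|jk].
by apply: nY; rewrite j1.
Qed.

Lemma height_dominance_set_op_dominance X Y : height_dominance X Y ->
  set_op_dominance X.1 X.2 Y.1 Y.2.
Proof.
case: X Y => [X1 X2] [Y1 Y2] h; split; first by case: h.
by move=> k u v _ cons nX; case: (height_dominance_ops h cons nX).
Qed.

Lemma set_op_dominance_set_op X Y u v :
  set_op_dominance X.1 X.2 Y.1 Y.2 -> adjacent u v -> set_op u v X <> X ->
  set_op u v Y <> Y /\
  set_op_dominance (set_op u v X).1 (set_op u v X).2
                   (set_op u v Y).1 (set_op u v Y).2.
Proof.
case: X Y => [X1 X2] [Y1 Y2] [e h] /[dup] a /consecutiveP c nX.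
have nY : set_op u v (Y1, Y2) <> (Y1, Y2).
  by apply: (h 1%N (fun=> u) (fun=> v) isT _ _ 1%N) => // j hj;
     rewrite (_ : j = 1%N) //; lia.
split=> //; split; first exact: (multeq_set_op e (adjacent_neq a) nX nY).
rewrite -!surjective_pairing => k p q k1 cons nX' j hj.
have := h k.+1 (fun i => if i == 1%N then u else p i.-1)
               (fun i => if i == 1%N then v else q i.-1) isT _ _ j.+1.
case: j hj => // j hj; rewrite !set_ops_prepend; apply; last lia.
  by case=> [|[|i]] // hi; apply: cons; lia.
by case=> [|[|i]] // hi; rewrite !set_ops_prepend; apply: nX'; lia.
Qed.

Lemma set_op_dominance_height X Y :
  set_op_dominance X.1 X.2 Y.1 Y.2 <-> height_dominance X Y.
Proof.
split; last exact: height_dominance_set_op_dominance.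
move=> h; split=> [|a b _]; first by case: h.
pose dom X Y := @set_op_dominance m X.1 X.2 Y.1 Y.2.
(* With the middle placed at 0, the restriction on crossing moves is void. *)
apply: (@dom_height m 0 dom) => //; first by move=> X' Y' [].
by move=> u v X' Y' hd a' _ nX; apply: set_op_dominance_set_op.
Qed.

End HeightDominance.

(** * Contiguous subsets as windows of positions *)

Section Contiguous.
Variable m : nat.
Implicit Types (u v x y z : 'I_m) (X Y : {set 'I_m} * {set 'I_m}).
Implicit Types (M S : {set 'I_m}).

Lemma sorted_enum_set M : sorted ltn (map val (enum M)).
Proof.
rewrite {1}/enum_mem -enumT /= sorted_map.
apply: (@sorted_filter _ (fun x y : 'I_m => (x < y)%N)).
  by move=> y x z; apply: ltn_trans.
by rewrite -(@sorted_map _ _ val ltn) val_enum_ord iota_ltn_sorted.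
Qed.

Lemma enum_val_ltn M (i j : 'I_#|M|) :
  (enum_val i < enum_val j)%N = (i < j)%N.
Proof.
have h (k l : 'I_#|M|) : (k < l)%N -> (enum_val k < enum_val l)%N.
  move=> kl; have x0 := enum_val k.
  rewrite !(enum_val_nth x0) -!(nth_map x0 0%N val) -?cardE //.
  have := sorted_enum_set M; rewrite -(@sorted_map _ _ id ltn) map_id => s.
  by apply: (sorted_ltn_nth ltn_trans) => //; rewrite inE size_map -cardE.
apply/idP/idP => [|/h //]; rewrite ltnNge => /negP hij; rewrite ltnNge; apply/negP.
rewrite leq_eqVlt => /predU1P[/val_inj e|/h/ltnW//].
by apply: hij; rewrite e.
Qed.

Definition rank M (k : nat) : nat := #|[set x in M | (x < k)%N]|.

Lemma rank_enum_val M (i : 'I_#|M|) : rank M (enum_val i) = i.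
Proof.
rewrite /rank -[RHS](card_ord i).
rewrite -(card_imset _ (f := fun j : 'I_i => enum_val (widen_ord (ltnW (ltn_ord i)) j))).
  congr #|pred_of_set _|; apply/setP => x; rewrite !inE; apply/andP/imsetP.
    case=> xM xi; have hx : (enum_rank_in (enum_valP i) x < i)%N.
      by rewrite -enum_val_ltn enum_rankK_in.
    exists (Ordinal hx) => //; rewrite -[LHS](enum_rankK_in (enum_valP i) xM).
    by congr enum_val; apply: val_inj.
  by case=> j _ ->; rewrite enum_valP enum_val_ltn; split=> //; exact: (ltn_ord j).
by move=> j k /enum_val_inj/(congr1 val) /= /val_inj.
Qed.

Lemma leq_rank M (a b : nat) : (a <= b)%N -> (rank M a <= rank M b)%N.
Proof.
move=> ab; apply: subset_leq_card; apply/subsetP => x; rewrite !inE.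
by case/andP=> -> xa; apply: leq_trans ab.
Qed.

Lemma ltn_rank M x (a : nat) : x \in M -> (x < a)%N -> (rank M x < rank M a)%N.
Proof.
move=> xM xa; apply: proper_card; apply/properP; split.
  by apply/subsetP => y; rewrite !inE => /andP[->] /ltn_trans; apply.
by exists x; rewrite !inE xM ?xa // ltnn.
Qed.

Lemma contiguous_interval M (a b : nat) :
  contiguous_in M [set x in M | (a <= x < b)%N].
Proof.
exists (rank M a), (rank M b); apply/setP => x; rewrite inE.
apply/andP/imsetP => [[xM /andP[ax xb]]|[s]].
  exists (enum_rank_in xM x); last by rewrite enum_rankK_in.
  have := rank_enum_val (enum_rank_in xM x); rewrite inE enum_rankK_in // => <-.
  by rewrite leq_rank // ltn_rank.
have := rank_enum_val s; rewrite inE => <- /andP[h1 h2] ->.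
split; first exact: enum_valP.
apply/andP; split; rewrite leqNgt; apply/negP => h.
  by have := ltn_rank (enum_valP s) h; rewrite ltnNge h1.
by move: h; rewrite ltnS => /(leq_rank M); rewrite leqNgt h2.
Qed.

Lemma contiguousP M S : contiguous_in M S ->
  exists a b : nat, (a <= b)%N /\ S = [set x in M | (a <= x < b)%N].
Proof.
case=> a [b ->]; case: (set_0Vmem [set s : 'I_#|M| | (a <= s < b)%N]) => [e|[s0]].
  exists 0%N, 0%N; split=> //; rewrite (_ : imset _ _ = set0).
    by apply/setP => x; rewrite !inE ltn0 !andbF.
  apply/setP => x; rewrite inE; apply/negbTE/imsetP => -[s hs _].
  by move/setP: e => /(_ s); move: hs; rewrite !inE => ->.
rewrite inE => h0.
case: (arg_minnP (P := fun s : 'I_#|M| => (a <= s < b)%N) (fun s => s : nat) h0) => lo hlo lo_min.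
case: (arg_maxnP (P := fun s : 'I_#|M| => (a <= s < b)%N) (fun s => s : nat) h0) => hi hhi hi_max.
have le_ev (i j : 'I_#|M|) : (enum_val i <= enum_val j)%N = (i <= j)%N.
  by rewrite leqNgt enum_val_ltn -leqNgt.
exists (enum_val lo), (enum_val hi).+1; split.
  by rewrite ltnW // ltnS le_ev; apply: lo_min.
apply/setP => x; rewrite inE; apply/imsetP/andP => [[s]|[xM]].
  rewrite inE => hs ->; rewrite enum_valP ltnS !le_ev; split=> //.
  by rewrite lo_min //; apply: hi_max.
rewrite -[x](enum_rankK_in xM xM) ltnS !le_ev => /andP[h1 h2].
by exists (enum_rank_in xM x); rewrite // inE; lia.
Qed.

Definition sym_diff X := (X.1 :\: X.2) :|: (X.2 :\: X.1).

Lemma bal_card X S : (forall x, x \in S -> bal X x != 0) ->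
  \sum_(x in S) bal X x = #|S :&: X.1|%:Z - #|S :&: X.2|%:Z /\
  (#|S :&: X.1| + #|S :&: X.2|)%N = #|S|.
Proof.
move=> hS; have c Z : #|S :&: Z| = (\sum_(x in S) (x \in Z))%N.
  by rewrite -sum1_card big_mkcond [RHS]big_mkcond; apply: eq_bigr => x _; rewrite inE; case: (x \in S).
split.
  rewrite !c -!natz !natr_sum -sumrB; apply: eq_bigr => x _.
  by rewrite balE !natz.
rewrite !c -big_split -sum1_card; apply: eq_bigr => x /hS; rewrite balE.
by case: (x \in _); case: (x \in _).
Qed.

Lemma sym_diffE X x : (x \in sym_diff X) = (bal X x != 0).
Proof. by rewrite !inE balE; case: (x \in _); case: (x \in _). Qed.

Lemma height_card X (a b : nat) (S := [set x in sym_diff X | (a <= x < b)%N]) :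
  (a <= b)%N ->
  [/\ height X b - height X a = #|S :&: X.1|%:Z - #|S :&: X.2|%:Z,
      (#|S :&: X.1| + #|S :&: X.2|)%N = #|S| &
      odd `|height X b - height X a|%N = odd #|S|].
Proof.
move=> ab; have [|e1 e2] := @bal_card X S.
  by move=> x; rewrite inE sym_diffE => /andP[].
have e : height X b - height X a = #|S :&: X.1|%:Z - #|S :&: X.2|%:Z.
  rewrite -e1 heightB // big_mkcond [RHS]big_mkcond; apply: eq_bigr => x _.
  by rewrite inE sym_diffE; case: eqP => [->|_]; rewrite ?if_same // andTb.
by split=> //; rewrite e -e2; lia.
Qed.

Lemma even_contiguous_dominance_height X Y :
  even_contiguous_dominance X.1 X.2 Y.1 Y.2 <-> height_dominance X Y.
Proof.
have sd : multeq X Y -> sym_diff X = sym_diff Y.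
  by move=> e; apply/setP => x; rewrite !sym_diffE (multeq_bal0 _ e).
split=> -[e h]; split=> //.
  move=> a b; wlog ab : a b / (a <= b)%N => [hw|].
    have [/hw//|/ltnW/hw] := leqP a b.
    by rewrite -abszN opprB distrC [X in _ -> _ <= X]distrC.
  have [e1 e2 ->] := height_card X ab; have [e3 e4 _] := height_card Y ab.
  move=> ev; have := h _ (contiguous_interval _ a b) ev.
  rewrite e1 e3 -/(sym_diff X); rewrite -!(sd e) in e3 e4 *; lia.
move=> S /contiguousP[a [b [ab ->]]]; rewrite -/(sym_diff X).
have [e1 e2 od] := height_card X ab; have [e3 e4 _] := height_card Y ab.
rewrite -od => /(h a b); rewrite e1 e3; rewrite -!(sd e) in e3 e4 *; lia.
Qed.

End Contiguous.

(** * Encoding row and column sets in one set of size 2n *)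

Section JoinRev.
Variable n : nat.
Implicit Types (P Q I J : {set 'I_n}).

Lemma lshift_or_rev (x : 'I_(n + n)) :
  (exists i : 'I_n, x = lshift n i) \/ (exists i : 'I_n, x = rev_ord (lshift n i)).
Proof.
have [xn|xn] := ltnP x n; [left|right].
  by exists (Ordinal xn); apply: val_inj.
have h : (n + n - x.+1 < n)%N by have := ltn_ord x; lia.
by exists (Ordinal h); apply: val_inj => /=; have := ltn_ord x; lia.
Qed.

Lemma lshift_neq_rev (i j : 'I_n) : lshift n i != rev_ord (lshift n j).
Proof. by rewrite -val_eqE /=; have := ltn_ord i; have := ltn_ord j; lia. Qed.

Lemma in_join_rev_l P Q i : (lshift n i \in join_rev P Q) = (i \in P).
Proof.
rewrite !inE mem_imset; last exact: lshift_inj.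
apply/orb_idr => /imsetP[j _ /eqP]; by rewrite (negPf (lshift_neq_rev i j)).
Qed.

Lemma in_join_rev_r P Q i : (rev_ord (lshift n i) \in join_rev P Q) = (i \in Q).
Proof.
rewrite !inE orbC (mem_imset (f := fun i => rev_ord (lshift n i))); last first.
  by move=> j k /rev_ord_inj/lshift_inj.
apply/orb_idr => /imsetP[j _ /esym/eqP]; by rewrite (negPf (lshift_neq_rev j i)).
Qed.

(* [crossed] is the encoding of the paper. In [uncrossed] the column sets are *)
(* complemented, so that each component depends on one minor only; the two    *)
(* differ just by exchanging the doubly occupied and the empty positions on   *)
(* the column side, which leaves balances and heights unchanged.              *)
Definition crossed P1 P2 Q1 Q2 := (join_rev P1 Q2, join_rev P2 Q1).
Definition uncrossed P1 P2 Q1 Q2 := (join_rev P1 (~: Q1), join_rev P2 (~: Q2)).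

Lemma bal_uncrossed P1 P2 Q1 Q2 x :
  bal (uncrossed P1 P2 Q1 Q2) x = bal (crossed P1 P2 Q1 Q2) x.
Proof.
case: (lshift_or_rev x) => -[i ->]; rewrite !balE.
  by rewrite !in_join_rev_l.
by rewrite !in_join_rev_r !inE; case: (_ \in _); case: (_ \in _).
Qed.

Lemma multeq_uncrossed P1 P2 Q1 Q2 I1 I2 J1 J2 :
  multeq (uncrossed P1 P2 Q1 Q2) (uncrossed I1 I2 J1 J2) <->
  multeq (crossed P1 P2 Q1 Q2) (crossed I1 I2 J1 J2).
Proof.
split=> h x; have := h x; case: (lshift_or_rev x) => -[i ->];
rewrite ?in_join_rev_l ?in_join_rev_r // !inE;
by do 4 case: (i \in _).
Qed.

Lemma height_dominance_uncrossed P1 P2 Q1 Q2 I1 I2 J1 J2 :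
  height_dominance (uncrossed P1 P2 Q1 Q2) (uncrossed I1 I2 J1 J2) <->
  height_dominance (crossed P1 P2 Q1 Q2) (crossed I1 I2 J1 J2).
Proof.
have e S1 S2 T1 T2 k :
    height (uncrossed S1 S2 T1 T2) k = height (crossed S1 S2 T1 T2) k.
  by apply: eq_bigr => x _; exact: bal_uncrossed.
split=> -[h1 h2]; split; try exact/multeq_uncrossed.
  by move=> a b; have := h2 a b; rewrite (e P1 P2 Q1 Q2) (e P1 P2 Q1 Q2)
    (e I1 I2 J1 J2) (e I1 I2 J1 J2).
by move=> a b; rewrite (e P1 P2 Q1 Q2) (e P1 P2 Q1 Q2)
  (e I1 I2 J1 J2) (e I1 I2 J1 J2); exact: h2.
Qed.

Lemma height_end m (X : {set 'I_m} * {set 'I_m}) k : (m <= k)%N ->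
  height X k.+1 = height X k.
Proof.
move=> mk; apply: eq_bigl => x; have := ltn_ord x; lia.
Qed.

(** On the reversed half the two sets exchange roles, so the balances occur in reverse order with
    opposite sign: the word retraces its heights. *)
Lemma height_doubled (R1 R2 : {set 'I_n}) k :
  height (crossed R1 R2 R1 R2) k = height (R1, R2) (minn k (n + n - k)).
Proof.
elim: k => [|k IH]; first by rewrite min0n /height !big_pred0.
have [kn|nk] := ltnP k n.
  rewrite (heightS _ (lshift n (Ordinal kn))) IH.
  rewrite (_ : minn k _ = Ordinal kn); last by rewrite /=; lia.
  rewrite (_ : minn _ _ = (Ordinal kn).+1); last by rewrite /=; lia.
  by rewrite heightS !balE /= !in_join_rev_l.
have [knn|nnk] := ltnP k (n + n); last first.
  by rewrite height_end // IH; congr height; lia.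
have h : (n + n - k.+1 < n)%N by lia.
rewrite (_ : k = rev_ord (lshift n (Ordinal h))); last by rewrite /=; lia.
rewrite heightS.
rewrite (_ : nat_of_ord (rev_ord _) = k) ?IH; last by rewrite /=; lia.
rewrite (_ : minn k _ = (Ordinal h).+1); last by rewrite /=; lia.
rewrite (_ : minn k.+1 _ = Ordinal h); last by rewrite /=; lia.
by rewrite heightS !balE !in_join_rev_r /=; ring.
Qed.

Lemma height_dominance_doubled (R1 R2 K1 K2 : {set 'I_n}) :
  height_dominance (crossed R1 R2 R1 R2) (crossed K1 K2 K1 K2) <->
  height_dominance (R1, R2) (K1, K2).
Proof.
split=> -[h1 h2]; split.
- by move=> x; have := h1 (lshift n x); rewrite !in_join_rev_l.
- move=> a b; have := h2 (minn a n) (minn b n); rewrite !height_doubled.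
  (* Heights are constant from [n] on, so cuts may be truncated to [n], where the doubled word has
     not yet turned back. *)
  have e (X : {set 'I_n} * {set 'I_n}) k :
     height X k = height X (minn (minn k n) (n + n - minn k n)).
    by apply: eq_bigl => x; have := ltn_ord x; lia.
  by rewrite -!e.
- move=> x; case: (lshift_or_rev x) => -[i ->].
    by rewrite !in_join_rev_l; exact: h1.
  by rewrite !in_join_rev_r addnC [RHS]addnC; exact: h1.
- by move=> a b; rewrite !height_doubled; exact: h2.
Qed.

End JoinRev.

(** * Minors and Pluecker coordinates *)

Section Minors.
Variables (R : realType).

(** The value 0 for sets of different sizes makes minors total, so that index sets can be rewritten
    without transporting a proof of equal cardinality. *)
Definition set_minor m (A : 'M[R]_m) (X Y : {set 'I_m}) : R :=
  if @eqP _ #|X| #|Y| is ReflectT e then minor A e else 0.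

Lemma set_minorE m (A : 'M[R]_m) (X Y : {set 'I_m}) (e : #|X| = #|Y|) : set_minor A X Y = minor A e.
Proof. by rewrite /set_minor; case: eqP => // e'; rewrite (eq_irrelevance e e'). Qed.

Lemma set_minor_neq m (A : 'M[R]_m) (X Y : {set 'I_m}) : #|X| != #|Y| -> set_minor A X Y = 0.
Proof. by rewrite /set_minor; case: eqP. Qed.

Lemma totally_nonnegativeP m (A : 'M[R]_m) :
  totally_nonnegative A <-> forall X Y, 0 <= set_minor A X Y.
Proof.
split=> h X Y; last by move=> e; rewrite -set_minorE.
by rewrite /set_minor; case: eqP.
Qed.

Definition incr m k (r : 'I_k -> 'I_m) : Prop :=
  forall i j : 'I_k, (i < j)%N -> (r i < r j)%N.

Lemma incr_inj m k (r : 'I_k -> 'I_m) : incr r -> injective r.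
Proof.
by move=> h i j e; case: (ltngtP i j) => [/h|/h|/val_inj//]; rewrite e ltnn.
Qed.

Lemma incr_ltn m k (r : 'I_k -> 'I_m) i j : incr r -> (r i < r j)%N = (i < j)%N.
Proof.
move=> h; apply/idP/idP => [|/h//]; rewrite ltnNge => /negP n; rewrite ltnNge.
by apply/negP; rewrite leq_eqVlt => /predU1P[/val_inj e|/h/ltnW//]; apply: n; rewrite e.
Qed.

(** The index of an element in an increasing enumeration is its rank, so the image determines the
    enumeration. Minors can thus be computed from any increasing listing of rows and columns. *)
Lemma incr_enum_val m k (r : 'I_k -> 'I_m) (X : {set 'I_m}) (e : #|X| = k) :
  incr r -> X = [set r i | i : 'I_k] ->
  r =1 (fun i => enum_val (cast_ord (esym e) i)).
Proof.
move=> hr hX i.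
have riX : r i \in X by rewrite hX imset_f.
rewrite -[LHS](enum_rankK_in riX riX); congr enum_val; apply: val_inj => /=.
rewrite -rank_enum_val enum_rankK_in // /rank hX -[RHS](card_ord i).
have iw := ltnW (ltn_ord i).
rewrite -(card_imset _ (f := fun j : 'I_i => r (widen_ord iw j))).
  congr #|pred_of_set _|; apply/setP => x; rewrite inE; apply/andP/imsetP.
    case=> /imsetP[j _ ->]; rewrite incr_ltn // => ji.
    by exists (Ordinal ji) => //; congr r; apply: val_inj.
  case=> j _ ->; split; first exact: imset_f.
  by rewrite incr_ltn //; exact: (ltn_ord j).
by move=> j l /(incr_inj hr)/(congr1 val) /= /val_inj.
Qed.

Lemma set_incr m (X : {set 'I_m}) k : #|X| = k ->
  exists2 r : 'I_k -> 'I_m, incr r & X = [set r i | i : 'I_k].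
Proof.
move=> e; exists (fun i => enum_val (cast_ord (esym e) i)).
  by move=> i j ij; rewrite enum_val_ltn.
apply/setP => x; apply/idP/imsetP => [xX|[i _ ->]]; last exact: enum_valP.
by exists (cast_ord e (enum_rank_in xX x)); rewrite ?cast_ordK ?enum_rankK_in.
Qed.

Lemma set_minor_enum_val m (A : 'M[R]_m) (X Y : {set 'I_m}) k (eX : #|X| = k) (eY : #|Y| = k) :
  set_minor A X Y = \det (mxsub (fun i => enum_val (cast_ord (esym eX) i))
                         (fun i => enum_val (cast_ord (esym eY) i)) A).
Proof.
case: k / eX eY => eY; rewrite (set_minorE _ (esym eY)) /minor.
congr (\det _); apply/matrixP => i j; rewrite !mxE cast_ord_id.
by congr (A _ (enum_val _)); apply: val_inj.
Qed.

Lemma set_minor_incr m (A : 'M[R]_m) k (r c : 'I_k -> 'I_m) : incr r -> incr c ->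
  set_minor A [set r i | i : 'I_k] [set c i | i : 'I_k] = \det (mxsub r c A).
Proof.
move=> hr hc.
have eX : #|[set r i | i : 'I_k]| = k by rewrite card_imset ?card_ord //; exact: incr_inj.
have eY : #|[set c i | i : 'I_k]| = k by rewrite card_imset ?card_ord //; exact: incr_inj.
rewrite (set_minor_enum_val A eX eY); congr (\det _); apply/matrixP => i j; rewrite !mxE.
by rewrite -(incr_enum_val eX hr erefl) -(incr_enum_val eY hc erefl).
Qed.

Lemma set_minor_tr m (A : 'M[R]_m) X Y : set_minor A^T X Y = set_minor A Y X.
Proof.
have [e|ne] := eqVneq #|X| #|Y|; last by rewrite !set_minor_neq // eq_sym.
rewrite (set_minor_enum_val _ e erefl) (set_minor_enum_val A erefl e) -det_tr.
by congr (\det _); apply/matrixP => i j; rewrite !mxE.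
Qed.

Definition upd (T : Type) k (r : 'I_k -> T) (i : 'I_k) (x : T) : 'I_k -> T :=
  fun j => if j == i then x else r j.

Lemma det_mxsub_upd m p k (A : 'M[R]_(m, p)) (r : 'I_k -> 'I_m) (c : 'I_k -> 'I_p)
    i0 v (B : 'M[R]_k) (a b : R) :
  (forall j, B i0 j = a * A (r i0) (c j) + b * A v (c j)) ->
  (forall i j, i != i0 -> B i j = A (r i) (c j)) ->
  \det B = a * \det (mxsub r c A) + b * \det (mxsub (upd r i0 v) c A).
Proof.
move=> h1 h2; apply: (determinant_multilinear (i0 := i0)).
- by apply/rowP => j; rewrite !mxE h1 /upd eqxx.
- by apply/matrixP => i j; rewrite !mxE h2 // eq_sym neq_lift.
- apply/matrixP => i j; rewrite !mxE h2 /upd; first by rewrite eq_sym (negPf (neq_lift _ _)).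
  by rewrite eq_sym neq_lift.
Qed.

Lemma det_mxsub_eq0 m p k (A : 'M[R]_(m, p)) (r : 'I_k -> 'I_m) (c : 'I_k -> 'I_p) i j :
  i != j -> r i = r j -> \det (mxsub r c A) = 0.
Proof.
by move=> ij e; apply: (determinant_alternate ij) => l; rewrite !mxE e.
Qed.

Lemma incr_upd m k (r : 'I_k -> 'I_m) i v : incr r -> adjacent (r i) v ->
  (forall j, r j != v) -> incr (upd r i v).
Proof.
move=> hr a nv j l jl; rewrite /upd.
have nj : nat_of_ord (r j) <> v by move=> /val_inj/eqP; exact/negP.
have nl : nat_of_ord (r l) <> v by move=> /val_inj/eqP; exact/negP.
move: a; rewrite /adjacent => a; have rjl := hr _ _ jl.
case: eqP => [ej|_]; case: eqP => [el|_] //.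
- by move: jl; rewrite ej el ltnn.
- by rewrite ej in rjl; lia.
- by rewrite el in rjl; lia.
Qed.

Definition addrow m u v t (A : 'M[R]_m) : 'M[R]_m :=
  \matrix_(i, j) (A i j + (if i == u then t * A v j else 0)).

(** Multilinearity in row [u]. Since [u] and [v] are adjacent, putting [v] in place of [u] keeps the
    rows in increasing order, so no sign appears; if [v] is already among the rows, the extra
    determinant has two equal rows. *)
Lemma set_minor_addrow m (u v : 'I_m) t (A : 'M[R]_m) X Y : adjacent u v ->
  set_minor (addrow u v t A) X Y =
  set_minor A X Y + t * (if acts u v X then set_minor A (replace_elt u v X) Y else 0).
Proof.
move=> a; have [e|ne] := eqVneq #|X| #|Y|; last first.
  by rewrite !set_minor_neq ?card_replace_elt // if_same mulr0 addr0.
have [k eY] : exists k, #|Y| = k by exists #|Y|.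
rewrite eY in e; have [r hr hX] := set_incr e; have [c hc hY] := set_incr eY.
have memX x : reflect (exists i, x = r i) (x \in X).
  by rewrite hX; apply: (iffP imsetP) => [[i]|[i]]; exists i.
have [uX|uX] := boolP (u \in X); last first.
  rewrite /acts (negPf uX) mulr0 addr0 hX hY !set_minor_incr //.
  congr (\det _); apply/matrixP => i j; rewrite !mxE.
  case: eqP => [ei|_]; rewrite ?addr0 //.
  by case/memX: uX; exists i.
have [i0 ui0] := memX _ uX.
transitivity (1 * \det (mxsub r c A) + t * \det (mxsub (upd r i0 v) c A)).
  rewrite {1}hX {1}hY set_minor_incr //; apply: det_mxsub_upd => [j|i j ii0]; rewrite !mxE.
    by rewrite ui0 eqxx mul1r.
  by rewrite ui0 (inj_eq (incr_inj hr)) (negPf ii0) addr0.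
rewrite mul1r -set_minor_incr // -hX -hY /acts uX /=; congr (_ + _ * _).
have [vX|vX] := boolP (v \in X).
  have [i1 vi1] := memX _ vX.
  have i10 : i0 != i1.
    by apply: contraTneq a => ei; rewrite vi1 -ei -ui0 /adjacent; lia.
  apply: (det_mxsub_eq0 _ _ i10).
  by rewrite /upd eqxx eq_sym (negPf i10).
have nv j : r j != v by apply: contraNneq vX => <-; apply/memX; exists j.
have au : acts u v X by rewrite /acts uX.
rewrite -set_minor_incr -?hY //; last by apply: incr_upd => //; rewrite -ui0.
congr set_minor; apply/setP => x; rewrite in_replace_elt au.
apply/imsetP/orP => [[i _ ->]|[/eqP->|/andP[xu /memX[i xi]]]].
- rewrite /upd; have [ii|ii] := eqVneq i i0; first by left.
  by right; rewrite ui0 (inj_eq (incr_inj hr)) ii /=; apply/memX; exists i.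
- by exists i0 => //; rewrite /upd eqxx.
- exists i => //; rewrite /upd; case: eqP => // ii.
  by move: xu; rewrite xi ii -ui0 eqxx.
Qed.

Definition addcol m u v t (A : 'M[R]_m) : 'M[R]_m := (addrow u v t A^T)^T.

Lemma set_minor_addcol m (u v : 'I_m) t (A : 'M[R]_m) X Y : adjacent u v ->
  set_minor (addcol u v t A) X Y =
  set_minor A X Y + t * (if acts u v Y then set_minor A X (replace_elt u v Y) else 0).
Proof. by move=> a; rewrite set_minor_tr set_minor_addrow // !set_minor_tr. Qed.

Definition scalerow m u s (A : 'M[R]_m) : 'M[R]_m :=
  \matrix_(i, j) ((if i == u then s else 1) * A i j).

Lemma set_minor_scalerow m (u : 'I_m) s (A : 'M[R]_m) X Y :
  set_minor (scalerow u s A) X Y = (if u \in X then s else 1) * set_minor A X Y.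
Proof.
have [e|ne] := eqVneq #|X| #|Y|; last by rewrite !set_minor_neq // mulr0.
have [k eY] : exists k, #|Y| = k by exists #|Y|.
rewrite eY in e; have [r hr hX] := set_incr e; have [c hc hY] := set_incr eY.
rewrite {1 3}hX hY !set_minor_incr //; have [|uX] := boolP (u \in X); last first.
  rewrite mul1r; congr (\det _); apply/matrixP => i j; rewrite !mxE.
  case: eqP => [ei|_]; rewrite ?mul1r //.
  by case/negP: uX; rewrite -ei hX imset_f.
rewrite {1}hX => /imsetP[i0 _ ui0].
rewrite (@det_mxsub_upd _ _ _ A r c i0 u _ s 0) ?mul0r ?addr0 // => [j|i j ii0].
  by rewrite !mxE ui0 eqxx mul0r addr0.
by rewrite !mxE ui0 (inj_eq (incr_inj hr)) (negPf ii0) mul1r.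
Qed.

Definition scalecol m u s (A : 'M[R]_m) : 'M[R]_m := (scalerow u s A^T)^T.

Lemma set_minor_scalecol m (u : 'I_m) s (A : 'M[R]_m) X Y :
  set_minor (scalecol u s A) X Y = (if u \in Y then s else 1) * set_minor A X Y.
Proof. by rewrite set_minor_tr set_minor_scalerow set_minor_tr. Qed.

Lemma incr_lift m k (r : 'I_k.+1 -> 'I_m) i : incr r -> incr (r \o lift i).
Proof. by move=> hr j l jl; apply: hr; rewrite /= !ltnNge leq_bump2 -ltnNge. Qed.

Lemma incr_lift_setD1 m k (r : 'I_k.+1 -> 'I_m) i : incr r ->
  [set (r \o lift i) j | j : 'I_k] = [set r j | j : 'I_k.+1] :\ r i.
Proof.
move=> hr; apply/setP => x; rewrite !inE; apply/imsetP/andP.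
  case=> j _ -> /=; split; last exact: imset_f.
  by rewrite (inj_eq (incr_inj hr)) eq_sym neq_lift.
case=> xi /imsetP[j _ xj]; move: xi; rewrite xj (inj_eq (incr_inj hr)) eq_sym.
by case/unlift_some => l jl _; exists l; rewrite // jl.
Qed.

Definition addcorner m t (A : 'M[R]_m.+1) : 'M[R]_m.+1 :=
  \matrix_(i, j) (A i j + (if (i == ord_max) && (j == ord_max) then t else 0)).

Lemma incr_ord_max m k (r : 'I_k.+1 -> 'I_m.+1) : incr r ->
  ord_max \in [set r i | i : 'I_k.+1] -> r ord_max = ord_max.
Proof.
move=> hr /imsetP[i _ ei]; apply: val_inj => /=; apply/eqP.
rewrite eqn_leq -ltnS ltn_ord /=; move/(congr1 val): ei => /= {1}->.
have [->//|ne] := eqVneq i ord_max.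
by apply/ltnW/hr => /=; move: ne; rewrite -val_eqE /=; have := ltn_ord i; lia.
Qed.

(** The corner is the last row and last column of every submatrix containing it, so its cofactor
    carries a plus sign. *)
Lemma set_minor_addcorner m t (A : 'M[R]_m.+1) X Y :
  set_minor (addcorner t A) X Y = set_minor A X Y +
    t * (if (ord_max \in X) && (ord_max \in Y)
         then set_minor A (X :\ ord_max) (Y :\ ord_max) else 0).
Proof.
have [e|ne] := eqVneq #|X| #|Y|; last first.
  rewrite !(set_minor_neq _ ne) add0r; have [/andP[hx hy]|_] := ifPn; last by rewrite mulr0.
  rewrite set_minor_neq ?mulr0 //; apply: contraNneq ne => ec.
  by rewrite (cardsD1 ord_max X) (cardsD1 ord_max Y) hx hy ec.
case: ifP => [/andP[hx hy]|hxy]; last first.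
  rewrite mulr0 addr0; have [k eY] : exists k, #|Y| = k by exists #|Y|.
  rewrite eY in e; have [r hr hX] := set_incr e; have [c hc hY] := set_incr eY.
  rewrite {1 2}hX {1 2}hY !set_minor_incr //; congr (\det _); apply/matrixP => i j; rewrite !mxE.
  case: ifP => [/andP[/eqP ei /eqP ej]|_]; rewrite ?addr0 //.
  by move: hxy; rewrite hX hY -{1}ei -{1}ej !imset_f.
have : #|Y| != 0%N by rewrite (cardsD1 ord_max Y) hy.
case ek: #|Y| => [//|k] _; rewrite ek in e.
have [r hr hX] := set_incr e; have [c hc hY] := set_incr ek.
have rm : r ord_max = ord_max by apply: incr_ord_max; rewrite -?hX.
have cm : c ord_max = ord_max by apply: incr_ord_max; rewrite -?hY.
rewrite -{1}rm -{1}cm hX hY -!incr_lift_setD1 // !set_minor_incr //; try exact: incr_lift.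
rewrite (expand_det_row _ ord_max) [in RHS](expand_det_row _ ord_max).
rewrite (bigD1 ord_max) //= [in RHS](bigD1 ord_max) //=.
have cof j : cofactor (mxsub r c (addcorner t A)) ord_max j =
    cofactor (mxsub r c A) ord_max j.
  rewrite /cofactor; congr (_ * \det _); apply/matrixP => i l; rewrite !mxE.
  by rewrite -{1}rm (inj_eq (incr_inj hr)) eq_sym (negPf (neq_lift _ _)) addr0.
rewrite cof !mxE rm cm eqxx /= mulrDl -!addrA; congr (_ + _).
rewrite addrC; congr (_ + _).
  apply: eq_bigr => j jm; rewrite cof !mxE -{2}cm (inj_eq (incr_inj hc)) (negPf jm).
  by rewrite andbF addr0.
rewrite /cofactor addnn -signr_odd odd_double expr0 mul1r; congr (_ * \det _).
by apply/matrixP => i j; rewrite !mxE.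
Qed.

Lemma tn_scalerow m (A : 'M[R]_m) i (s : R) : 0 <= s ->
  totally_nonnegative A -> totally_nonnegative (scalerow i s A).
Proof.
move=> s0 /totally_nonnegativeP h; apply/totally_nonnegativeP => X Y.
by rewrite set_minor_scalerow mulr_ge0 //; case: ifP.
Qed.

Lemma tn_tr m (A : 'M[R]_m) : totally_nonnegative A -> totally_nonnegative A^T.
Proof.
by move=> /totally_nonnegativeP h; apply/totally_nonnegativeP => X Y; rewrite set_minor_tr.
Qed.

Lemma tn_scalecol m (A : 'M[R]_m) i (s : R) : 0 <= s ->
  totally_nonnegative A -> totally_nonnegative (scalecol i s A).
Proof. by move=> s0 tA; apply/tn_tr/tn_scalerow/tn_tr. Qed.

End Minors.

(** * Minors as functions of one subset of [2n] *)

Section PluckerCoordinates.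
Variables (R : realType) (n : nat).
Implicit Types (A : 'M[R]_n) (Z : {set 'I_(n + n)}) (P Q : {set 'I_n}).

Definition rowsof Z : {set 'I_n} := [set i | lshift n i \in Z].
Definition colsof Z : {set 'I_n} := [set j | rev_ord (lshift n j) \notin Z].

(* The Pluecker coordinates of A: complementing the column set turns a minor  *)
(* into a function of a single n-subset of [2n].                              *)
Definition plucker A Z : R := set_minor A (rowsof Z) (colsof Z).

Lemma rowsof_join P Q : rowsof (join_rev P (~: Q)) = P.
Proof. by apply/setP => i; rewrite inE in_join_rev_l. Qed.

Lemma colsof_join P Q : colsof (join_rev P (~: Q)) = Q.
Proof. by apply/setP => i; rewrite inE in_join_rev_r inE negbK. Qed.

Lemma plucker_join A P Q : plucker A (join_rev P (~: Q)) = set_minor A P Q.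
Proof. by rewrite /plucker rowsof_join colsof_join. Qed.

Lemma join_rowscols Z : join_rev (rowsof Z) (~: colsof Z) = Z.
Proof.
apply/setP => x; case: (lshift_or_rev x) => -[i ->].
  by rewrite in_join_rev_l inE.
by rewrite in_join_rev_r !inE negbK.
Qed.

Lemma card_join_rev P Q : #|join_rev P Q| = (#|P| + #|Q|)%N.
Proof.
rewrite /join_rev cardsU disjoint_setI0 ?cards0 ?subn0.
  rewrite !card_imset //; last exact: lshift_inj.
  by move=> i j /rev_ord_inj/lshift_inj.
apply/pred0P => x /=; apply/negbTE/andP => -[/imsetP[i _ ->] /imsetP[j _ /eqP]].
by rewrite (negPf (lshift_neq_rev i j)).
Qed.

Lemma card_rowscols Z : (#|Z| + #|colsof Z| = #|rowsof Z| + n)%N.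
Proof.
rewrite -{1}(join_rowscols Z) card_join_rev -addnA; congr (_ + _)%N.
by rewrite addnC cardsC card_ord.
Qed.

Lemma totally_nonnegative_pluckerP A : totally_nonnegative A <-> forall Z, 0 <= plucker A Z.
Proof.
rewrite totally_nonnegativeP; split=> h => [Z|X Y]; first exact: h.
by rewrite -plucker_join.
Qed.

Lemma plucker_scalerow A i s Z :
  plucker (scalerow i s A) Z = (if lshift n i \in Z then s else 1) * plucker A Z.
Proof. by rewrite /plucker set_minor_scalerow inE. Qed.

Lemma plucker_scalecol A i s Z :
  plucker (scalecol i s A) Z =
  (if rev_ord (lshift n i) \in Z then 1 else s) * plucker A Z.
Proof. by rewrite /plucker set_minor_scalecol inE; case: (_ \in Z). Qed.

Lemma acts_rowsof (i j : 'I_n) Z :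
  acts i j (rowsof Z) = acts (lshift n i) (lshift n j) Z.
Proof. by rewrite /acts !inE. Qed.

Lemma acts_colsof (i j : 'I_n) Z :
  acts i j (colsof Z) = acts (rev_ord (lshift n j)) (rev_ord (lshift n i)) Z.
Proof. by rewrite /acts !inE negbK andbC. Qed.

Lemma rowsof_replace_l (i j : 'I_n) Z :
  rowsof (replace_elt (lshift n i) (lshift n j) Z) = replace_elt i j (rowsof Z).
Proof.
apply/setP => k; rewrite inE !in_replace_elt acts_rowsof inE.
by rewrite !(inj_eq (@lshift_inj _ _)).
Qed.

Lemma colsof_replace_l (i j : 'I_n) Z :
  colsof (replace_elt (lshift n i) (lshift n j) Z) = colsof Z.
Proof.
apply/setP => k; rewrite !inE !in_replace_elt.
by rewrite !(eq_sym (rev_ord _)) !(negPf (lshift_neq_rev _ _)) /= if_same.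
Qed.

Lemma rowsof_replace_r (i j : 'I_n) Z :
  rowsof (replace_elt (rev_ord (lshift n i)) (rev_ord (lshift n j)) Z) = rowsof Z.
Proof.
apply/setP => k; rewrite !inE !in_replace_elt.
by rewrite !(negPf (lshift_neq_rev _ _)) /= if_same.
Qed.

Lemma colsof_replace_r (i j : 'I_n) Z :
  colsof (replace_elt (rev_ord (lshift n i)) (rev_ord (lshift n j)) Z) =
  replace_elt j i (colsof Z).
Proof.
apply/setP => k; rewrite !inE !in_replace_elt acts_colsof !inE.
rewrite !(inj_eq rev_ord_inj) !(inj_eq (@lshift_inj _ _)).
rewrite /acts; have [->|ki] := eqVneq k i; have [->|kj] := eqVneq _ j => //=.
all: do 2 case: (_ \in Z) => //=.
Qed.

End PluckerCoordinates.

(** * Elementary operations on matrices as moves on coordinates *)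

Section Moves.
Variables (R : realType).

Definition moved n (A : 'M[R]_n) u v Z : R :=
  if acts u v Z then plucker A (replace_elt u v Z) else 0.

Lemma plucker_addrow n (A : 'M[R]_n) (i j : 'I_n) t Z : adjacent i j ->
  plucker (addrow i j t A) Z = plucker A Z + t * moved A (lshift n i) (lshift n j) Z.
Proof.
move=> a; rewrite /plucker set_minor_addrow // acts_rowsof /moved /plucker.
by rewrite rowsof_replace_l colsof_replace_l.
Qed.

Lemma plucker_addcol n (A : 'M[R]_n) (i j : 'I_n) t Z : adjacent i j ->
  plucker (addcol i j t A) Z =
  plucker A Z + t * moved A (rev_ord (lshift n j)) (rev_ord (lshift n i)) Z.
Proof.
move=> a; rewrite /plucker set_minor_addcol // acts_colsof /moved /plucker.
by rewrite rowsof_replace_r colsof_replace_r.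
Qed.

Lemma plucker_addcorner n (A : 'M[R]_n.+1) t Z :
  plucker (addcorner t A) Z = plucker A Z +
    t * moved A (lshift n.+1 ord_max) (rev_ord (lshift n.+1 ord_max)) Z.
Proof.
rewrite /plucker set_minor_addcorner /moved /plucker /acts !inE; congr (_ + _ * _).
case: ifP => // h; congr set_minor; apply/setP => k; rewrite !inE in_replace_elt /acts h.
  by rewrite (negPf (lshift_neq_rev _ _)) (inj_eq (@lshift_inj _ _)).
rewrite (inj_eq rev_ord_inj) (inj_eq (@lshift_inj _ _)).
by rewrite (eq_sym (rev_ord _)) (lshift_neq_rev _ _) /= negb_or.
Qed.

(** Moves in the lower half are row additions and moves in the upper half are column additions with
    source and target exchanged. The upward move across the middle adds [t] to the bottom right
    entry. *)
Lemma plucker_move n (A : 'M[R]_n) (u v : 'I_(n + n)) t :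
  adjacent u v -> ((u < n) == (v < n))%N || (u < v)%N ->
  exists A', forall Z, plucker A' Z = plucker A Z + t * moved A u v Z.
Proof.
case: (lshift_or_rev u) => -[i ->]; case: (lshift_or_rev v) => -[j ->];
  move=> a {u v}.
- move=> _; exists (addrow i j t A) => Z; apply: plucker_addrow.
  by move: a; rewrite /adjacent.
- case: n A i j a => [|n] A i j a _; first by have := ltn_ord i.
  exists (addcorner t A) => Z; rewrite plucker_addcorner.
  have -> : i = ord_max.
    by apply: val_inj; move: a; rewrite /adjacent /=; have := ltn_ord i; have := ltn_ord j; lia.
  suff -> : j = ord_max by [].
  by apply: val_inj; move: a; rewrite /adjacent /=; have := ltn_ord i; have := ltn_ord j; lia.
- move: a; rewrite /adjacent /=; have := ltn_ord i; have := ltn_ord j; lia.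
- move=> _; exists (addcol j i t A) => Z; apply: plucker_addcol.
  by move: a; rewrite /adjacent /=; have := ltn_ord i; have := ltn_ord j; lia.
Qed.

Variable n : nat.
Implicit Types (A : 'M[R]_n) (Z : {set 'I_(n + n)}).

Lemma moved_ge0 A u v Z : totally_nonnegative A -> 0 <= moved A u v Z.
Proof. by move=> /totally_nonnegative_pluckerP h; rewrite /moved; case: ifP. Qed.

(* Applying the moves from u to u+1, for u in s, with parameter t = 1.        *)
Lemma sweep A (s : seq nat) : totally_nonnegative A ->
  exists2 A', totally_nonnegative A' & forall Z, plucker A Z <= plucker A' Z /\
    forall u v : 'I_(n + n), (u : nat) \in s -> v = u.+1 :> nat ->
      acts u v Z -> plucker A (replace_elt u v Z) <= plucker A' Z.
Proof.
move=> tA; elim: s => [|a s [A1 tA1 h1]]; first by exists A.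
have [an|an] := ltnP a.+1 (n + n); last first.
  exists A1 => // Z; have [h2 h3] := h1 Z; split=> // u v; rewrite inE => /predU1P[->|us].
    by move=> ev; have := ltn_ord v; lia.
  exact: h3.
pose u0 := Ordinal (ltnW an); pose v0 := Ordinal an.
have a0 : adjacent u0 v0 by rewrite /adjacent /= eqxx.
have g0 : ((u0 < n) == (v0 < n))%N || (u0 < v0)%N by rewrite /=; lia.
have [A2 h2] := plucker_move A1 1 a0 g0.
exists A2.
  by apply/totally_nonnegative_pluckerP => Z; rewrite h2 mul1r addr_ge0 ?moved_ge0 //; move/totally_nonnegative_pluckerP: tA1.
move=> Z; have [h3 h4] := h1 Z; have m0 := moved_ge0 u0 v0 Z tA1.
split; first by rewrite h2; lra.
move=> u v; rewrite inE => /predU1P[ua|us] ev ac; last first.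
  by have := h4 u v us ev ac; rewrite h2; lra.
have eu : u = u0 by apply: val_inj.
have ev' : v = v0 by apply: val_inj; rewrite /= ev ua.
rewrite h2 /moved -eu -ev' ac mul1r.
have [h5 _] := h1 (replace_elt u v Z); have /totally_nonnegative_pluckerP/(_ Z) := tA1; lra.
Qed.

Definition weight Z : nat := (\sum_(x in Z) (n + n - x))%N.

Lemma weight_replace_elt (u v : 'I_(n + n)) Z : acts u v Z -> v = u.+1 :> nat ->
  (weight (replace_elt u v Z) < weight Z)%N.
Proof.
move=> a ev; have /andP[uZ vZ] := a.
rewrite /replace_elt; rewrite /acts in a; rewrite a /weight setUC big_setU1 /=; last first.
  by rewrite !inE (negPf vZ) andbF.
rewrite [X in (_ < X)%N](big_setD1 u) //= ltn_add2r ev; have := ltn_ord v; lia.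
Qed.

(** A set of size [n] that is closed under successors is the upper half: a member below [n] would
    leave fewer than [n] positions for the complement. The upper half encodes the empty minor. *)
Lemma plucker_top A Z : #|Z| = n ->
  (forall u v : 'I_(n + n), v = u.+1 :> nat -> u \in Z -> v \in Z) -> plucker A Z = 1.
Proof.
move=> cZ up.
have rows0 : rowsof Z = set0.
  apply/setP => i; rewrite !inE; apply/negbTE/negP => iZ.
  have upi k (x : 'I_(n + n)) : x = (i + k)%N :> nat -> x \in Z.
    elim: k x => [|k IH] x ex.
      by rewrite (_ : x = lshift n i) //; apply: val_inj; rewrite /= ex addn0.
    have h : (i + k < n + n)%N by have := ltn_ord x; lia.
    apply: (up (Ordinal h)); first by rewrite ex /=; lia.
    exact: IH.
  have : (#|~: Z| <= i)%N.
    have iw : (i <= n + n)%N by have := ltn_ord i; lia.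
    rewrite -[X in (_ <= X)%N](card_ord i) -cardsT.
    apply: leq_trans (leq_imset_card (widen_ord iw) _).
    apply: subset_leq_card; apply/subsetP => x; rewrite inE => xZ.
    have xi : (x < i)%N.
      by rewrite ltnNge; apply: contraNN xZ => /subnKC e; apply: (upi (x - i)%N).
    by apply/imsetP; exists (Ordinal xi) => //; apply: val_inj.
  by have := cardsC Z; rewrite card_ord cZ; have := ltn_ord i; lia.
have cols0 : colsof Z = set0.
  by apply: cards0_eq; have := card_rowscols Z; rewrite rows0 cards0 cZ; lia.
by rewrite /plucker rows0 cols0 (set_minorE _ erefl) /minor; move: (submx_on _ _); rewrite cards0 => M; rewrite det_mx00.
Qed.

Lemma zero_tn : totally_nonnegative (0 : 'M[R]_n).
Proof.
have det_ge0 k (M : 'M[R]_k) : M = 0 -> 0 <= \det M.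
  by case: k M => [|k] M ->; rewrite ?det_mx00 ?ler01 // det0.
by move=> X Y e; apply: det_ge0; apply/matrixP => i j; rewrite !mxE.
Qed.

(* Sweeping repeatedly from the zero matrix makes all coordinates positive:   *)
(* every n-subset reaches the top one, of coordinate 1, by upward moves.      *)
Lemma exists_positive : exists2 A : 'M[R]_n, totally_nonnegative A &
  forall Z, #|Z| = n -> 0 < plucker A Z.
Proof.
suff [A tA hA] : exists2 A : 'M[R]_n, totally_nonnegative A &
    forall Z, #|Z| = n -> (weight Z < (weight setT).+1)%N -> 0 < plucker A Z.
  exists A => // Z cZ; apply: hA => //; rewrite ltnS /weight.
  rewrite big_mkcond [X in (_ <= X)%N]big_mkcond leq_sum // => x _.
  by rewrite inE; case: ifP.
elim: (weight setT).+1 => [|k [A tA hA]]; first by exists (0 : 'M[R]_n) => //; exact: zero_tn.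
have [A' tA' hA'] := sweep (iota 0 (n + n)) tA.
exists A' => // Z cZ wZ.
have [/existsP[u /existsP[v /andP[/eqP ev ac]]]|none] :=
  boolP [exists u : 'I_(n + n), [exists v : 'I_(n + n), (v == u.+1 :> nat) && acts u v Z]].
  apply: lt_le_trans (proj2 (hA' Z) u v _ ev ac); last by rewrite mem_iota ltn_ord.
  apply: hA; first by rewrite card_replace_elt.
  by have := weight_replace_elt ac ev; lia.
rewrite plucker_top // => u v ev uZ; move: none; rewrite negb_exists => /forallP/(_ u).
rewrite negb_exists => /forallP/(_ v).
by rewrite ev eqxx /acts uZ /= negbK.
Qed.

End Moves.

(** * Necessity *)

Section LeadingCoefficient.
Variable R : realFieldType.

Lemma quad_le0 (a b c : R) :
  (forall t, 0 <= t -> a + t * b + t ^+ 2 * c <= 0) -> c <= 0.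
Proof.
move=> h; rewrite leNgt; apply/negP => c0.
(* Evaluated at [1 + s], the quadratic term outweighs the other two by at least [c]. *)
pose s := (`|a| + `|b|) / c.
have s0 : 0 <= s by rewrite divr_ge0 ?addr_ge0 // ltW.
have sc : s * c = `|a| + `|b| by rewrite divfK // gt_eqF.
have := h (1 + s) (addr_ge0 ler01 s0).
have -> : a + (1 + s) * b + (1 + s) ^+ 2 * c =
   c + s * c + (a + `|a| + s * `|a|) + ((1 + s) * (b + `|b|)) by ring: sc.
have ha : - `|a| <= a by have := ler_norm (- a); rewrite normrN; lra.
have hb : - `|b| <= b by have := ler_norm (- b); rewrite normrN; lra.
have h1 : 0 <= s * `|a| by rewrite mulr_ge0.
have h2 : 0 <= (1 + s) * (b + `|b|) by rewrite mulr_ge0 //; lra.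
have := normr_ge0 a; have := normr_ge0 b; rewrite sc; lra.
Qed.

Lemma lin_le0 (a b : R) : (forall t, 0 <= t -> a + t * b <= 0) -> b <= 0.
Proof.
move=> h; rewrite leNgt; apply/negP => b0.
pose s := (`|a| + 1) / b.
have s0 : 0 <= s by rewrite divr_ge0 ?addr_ge0 // ltW.
have sc : s * b = `|a| + 1 by rewrite divfK // gt_eqF.
have := h s s0; rewrite sc.
have ha : - `|a| <= a by have := ler_norm (- a); rewrite normrN; lra.
lra.
Qed.

(** For [s = 1 + b / a] one has [s * a = a + b > b], which excludes a larger exponent on the left;
    the inverse of [s] excludes a larger one on the right. *)
Lemma expr_le_eq (a b : R) (i j : nat) : 0 < a -> 0 < b ->
  (forall s, 0 < s -> s ^+ i * a <= s ^+ j * b) -> i = j.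
Proof.
move=> a0 b0 h; apply/eqP; rewrite eqn_leq; apply/andP; split; rewrite leqNgt; apply/negP => ij.
  have s0 : 1 < 1 + b / a by rewrite ltrDl divr_gt0.
  have s1 : 0 < 1 + b / a := lt_trans ltr01 s0.
  have := h _ s1; rewrite -(subnK (ltnW ij)) exprD -mulrA mulrCA ler_pM2l ?exprn_gt0 //.
  case e : (i - j)%N => [|k]; first lia.
  have k1 : 1 <= (1 + b / a) ^+ k by rewrite exprn_ege1 // ltW.
  have e1 : (1 + b / a) * a = a + b by rewrite mulrDl mul1r divfK // gt_eqF.
  rewrite exprSr -mulrA e1; apply/negP; rewrite -ltNge.
  apply: lt_le_trans (_ : a + b <= _); first lra.
  by rewrite ler_peMl // ltW // addr_gt0.
have s0 : 1 < 1 + b / a by rewrite ltrDl divr_gt0.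
have s1 : 0 < 1 + b / a := lt_trans ltr01 s0.
have i0 : 0 < (1 + b / a)^-1 by rewrite invr_gt0.
have := h _ i0; rewrite !exprVn -(ler_pM2l (exprn_gt0 j s1)).
rewrite (mulVKf (lt0r_neq0 (exprn_gt0 j s1))).
rewrite -{1}(subnK (ltnW ij)) exprD -mulrA (mulVKf (lt0r_neq0 (exprn_gt0 i s1))).
case e : (j - i)%N => [|k]; first lia.
have k1 : 1 <= (1 + b / a) ^+ k by rewrite exprn_ege1 // ltW.
have e1 : (1 + b / a) * a = a + b by rewrite mulrDl mul1r divfK // gt_eqF.
rewrite exprSr -mulrA e1; apply/negP; rewrite -ltNge.
apply: lt_le_trans (_ : a + b <= _); first lra.
by rewrite ler_peMl // ltW // addr_gt0.
Qed.

End LeadingCoefficient.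

Section Necessity.
Variables (R : realType) (n : nat).
Implicit Types (A : 'M[R]_n) (Z : {set 'I_(n + n)}).
Implicit Types X Y : {set 'I_(n + n)} * {set 'I_(n + n)}.

Definition plucker_prod A X : R := plucker A X.1 * plucker A X.2.

Definition balanced X : Prop := #|X.1| = n /\ #|X.2| = n.

Definition plucker_dom X Y : Prop := [/\ balanced X, balanced Y &
  forall A, totally_nonnegative A -> plucker_prod A X <= plucker_prod A Y].

Lemma balanced_set_op u v X : balanced X -> balanced (set_op u v X).
Proof. by case=> h1 h2; split; rewrite card_replace_elt. Qed.

(** Scaling a row by [s] multiplies each product by [s] to the multiplicity of that row. On a matrix
    with positive coordinates, the inequality for all [s > 0] forces equal exponents; columns give
    the complementary multiplicities. *)
Lemma plucker_dom_multeq X Y : plucker_dom X Y -> multeq X Y.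
Proof.
move=> [[x1 x2] [y1 y2] h] x; have [A tA hA] := exists_positive R n.
have gX : 0 < plucker_prod A X by rewrite mulr_gt0 ?hA.
have gY : 0 < plucker_prod A Y by rewrite mulr_gt0 ?hA.
case: (lshift_or_rev x) => -[i ->].
  apply: (expr_le_eq gX gY) => s s0.
  have := h _ (tn_scalerow i (ltW s0) tA); rewrite /plucker_prod !plucker_scalerow !exprD.
  do 4 case: (_ \in _); rewrite ?expr1 ?expr0; lra.
suff e : ((rev_ord (lshift n i) \notin X.1) + (rev_ord (lshift n i) \notin X.2) =
          (rev_ord (lshift n i) \notin Y.1) + (rev_ord (lshift n i) \notin Y.2))%N.
  by move: e; do 4 case: (_ \in _).
apply: (expr_le_eq gX gY) => s s0.
have := h _ (tn_scalecol i (ltW s0) tA); rewrite /plucker_prod !plucker_scalecol !exprD.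
do 4 case: (_ \in _); rewrite ?expr1 ?expr0; lra.
Qed.

(** The coefficient of [t] in the product of the two coordinates after a move with parameter [t]. *)
Definition linpart A u v X : R :=
  moved A u v X.1 * plucker A X.2 + plucker A X.1 * moved A u v X.2.

Lemma linpart_one A u v X : ~~ (acts u v X.1 && acts u v X.2) ->
  linpart A u v X = if acts u v X.1 || acts u v X.2 then plucker_prod A (set_op u v X) else 0.
Proof.
rewrite /linpart /moved /plucker_prod /set_op /=.
have [a1|a1] := boolP (acts u v X.1); have [a2|a2] := boolP (acts u v X.2) => // _ /=.
- by rewrite (replace_elt_id a2) mulr0 addr0.
- by rewrite (replace_elt_id a1) mul0r add0r.
- by rewrite mulr0 mul0r addr0.
Qed.

Lemma plucker_dom_move X Y u v A : plucker_dom X Y -> adjacent u v ->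
  ((u < n) == (v < n))%N || (u < v)%N -> totally_nonnegative A ->
  forall t, 0 <= t ->
  plucker_prod A X - plucker_prod A Y + t * (linpart A u v X - linpart A u v Y) +
  t ^+ 2 * (moved A u v X.1 * moved A u v X.2 - moved A u v Y.1 * moved A u v Y.2) <= 0.
Proof.
move=> [_ _ h] a g tA t t0; have [A' hA'] := plucker_move A t a g.
have tA' : totally_nonnegative A'.
  by apply/totally_nonnegative_pluckerP => Z; rewrite hA' addr_ge0 ?mulr_ge0 ?moved_ge0 //; move/totally_nonnegative_pluckerP: tA.
have := h _ tA'; rewrite /plucker_prod !hA' /linpart.
set p1 := plucker A X.1; set p2 := plucker A X.2; set q1 := plucker A Y.1; set q2 := plucker A Y.2.
move: (moved _ _ _ _) (moved A _ _ X.2) (moved A _ _ Y.1) (moved A _ _ Y.2) => m1 m2 l1 l2.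
rewrite -subr_le0; apply: le_trans; rewrite le_eqVlt; apply/orP; left; apply/eqP; ring.
Qed.

(* The leading coefficients in t of the inequality for the moved matrix give  *)
(* the inequality for the moved sets; if only X moved, the left-hand side     *)
(* would grow linearly on a matrix with positive minors.                      *)
Lemma plucker_dom_set_op u v X Y : plucker_dom X Y -> adjacent u v ->
  ((u < n) == (v < n))%N || (u < v)%N -> set_op u v X <> X ->
  set_op u v Y <> Y /\ plucker_dom (set_op u v X) (set_op u v Y).
Proof.
move=> d a g /set_op_neq nX; have e := plucker_dom_multeq d.
have [bX bY _] := d; have mv := plucker_dom_move d a g.
have both : (acts u v X.1 && acts u v X.2) = (acts u v Y.1 && acts u v Y.2).
  move: (e u) (e v); rewrite /acts.
  by do 4 case: (u \in _); do 4 case: (v \in _).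
have [/[dup] b1|nb] := boolP (acts u v X.1 && acts u v X.2).
  rewrite both => b2; split; first by apply/set_op_neq; case/andP: b2 => ->.
  split=> [||A tA]; try exact: balanced_set_op.
  have := quad_le0 (mv A tA); rewrite /moved /plucker_prod /=.
  by case/andP: b1 => -> ->; case/andP: b2 => -> ->; rewrite subr_le0.
have lin A : totally_nonnegative A -> linpart A u v X <= linpart A u v Y.
  move=> tA; rewrite -subr_le0; apply: (@lin_le0 _ (plucker_prod A X - plucker_prod A Y)) => t t0.
  have m0 (Z : {set 'I_(n + n)} * {set 'I_(n + n)}) : ~~ (acts u v Z.1 && acts u v Z.2) ->
      moved A u v Z.1 * moved A u v Z.2 = 0.
    by rewrite /moved negb_and => /orP[] /negPf->; rewrite ?mul0r ?mulr0.
  by have := mv A tA t t0; rewrite !m0 -?both // subrr mulr0 addr0.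
have nY : acts u v Y.1 || acts u v Y.2.
  apply: contraT => nY; have [A tA hA] := exists_positive R n.
  have := lin A tA; rewrite !linpart_one -?both // nX (negPf nY).
  by case: bX => x1 x2; rewrite leNgt mulr_gt0 // hA // card_replace_elt.
split; first exact/set_op_neq.
split=> [||A tA]; try exact: balanced_set_op.
by have := lin A tA; rewrite !linpart_one -?both // nX nY.
Qed.

Lemma plucker_dom_height X Y : plucker_dom X Y -> height_dominance X Y.
Proof.
move=> d; split=> [|p q _]; first exact: plucker_dom_multeq.
exact: (dom_height plucker_dom_multeq (n := n) plucker_dom_set_op).
Qed.

End Necessity.

(** * Noncrossing diagrams *)

Section Noncrossing.
Variable m : nat.
Implicit Types (f : 'I_m -> 'I_m) (u v x y z : 'I_m).

Definition noncrossing f : Prop :=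
  involutive f /\ forall x y, (x < y < f x)%N -> (x < f y < f x)%N.

Lemma noncrossing_between f x y : noncrossing f ->
  (minn x (f x) < y < maxn x (f x))%N -> (minn x (f x) < f y < maxn x (f x))%N.
Proof.
case=> inv nc h; have [xf|fx] := leqP x (f x).
  by have := nc x y; lia.
by have := nc (f x) y; rewrite inv; lia.
Qed.

Lemma ord_neq x y : x != y -> (x : nat) <> y.
Proof. by move=> /eqP h /val_inj. Qed.

Lemma tperm_ltn2 u v x y : adjacent u v ->
  ~ (x = u /\ y = v) -> ~ (x = v /\ y = u) ->
  (tperm u v x < tperm u v y)%N = (x < y)%N.
Proof.
rewrite /adjacent => a h1 h2.
have n1 : x = u -> (y : nat) <> v by move=> e /val_inj e'; apply: h1.
have n2 : x = v -> (y : nat) <> u by move=> e /val_inj e'; apply: h2.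
have n3 z w : z <> w -> (z : nat) <> w by move=> h /val_inj.
case: tpermP => [ex|ex|/n3 e1 /n3 e2]; case: tpermP => [ey|ey|/n3 e3 /n3 e4] //.
all: try (have := n1 ex); try (have := n2 ex); rewrite ?ex ?ey => *; apply/idP/idP; lia.
Qed.

Definition swapped u v f : 'I_m -> 'I_m := fun x => tperm u v (f (tperm u v x)).

(** A fixed point carries no arc, so the end of an arc may slide past it without creating a
    crossing. *)
Lemma noncrossing_swapped f u v : noncrossing f -> adjacent u v ->
  f u = u \/ f v = v -> noncrossing (swapped u v f).
Proof.
move=> [inv nc] a fixed; split=> [x|]; first by rewrite /swapped tpermK inv tpermK.
wlog fu : u v a {fixed} / f u = u => [hw|].
  case: fixed => [/hw|]; first exact.
  by move=> fv; rewrite /swapped tpermC; apply: hw => //; rewrite /adjacent orbC.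
have fo x : x != u -> f x != u by apply: contraNneq => e; rewrite -(inv x) e fu.
have lt x y : x != u -> y != u -> (tperm u v x < tperm u v y)%N = (x < y)%N.
  by move=> /eqP xu /eqP yu; apply: tperm_ltn2 => // -[].
move=> x y; rewrite -{1 3}(tpermK u v x) -{1 2}(tpermK u v y) /swapped.
move: (tperm u v x) (tperm u v y) => {}x {}y.
have [->|xu] := eqVneq x u; first by rewrite fu; lia.
have [->|yu] := eqVneq y u; first by rewrite fu.
by rewrite !lt ?fo //; exact: nc.
Qed.

Lemma noncrossing_pair f u v : noncrossing f -> adjacent u v ->
  f u = u -> f v = v -> noncrossing (fun x => f (tperm u v x)).
Proof.
move=> [inv nc] a fu fv; have nuv := adjacent_neq a.
have fo x : x != u -> x != v -> (f x != u) && (f x != v).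
  move=> xu xv; apply/andP; split.
    by apply: contraNneq xu => e; rewrite -(inv x) e fu.
  by apply: contraNneq xv => e; rewrite -(inv x) e fv.
split=> [x|x y].
  case: (tpermP u v x) => [->|->|/eqP xu /eqP xv]; rewrite ?fv ?fu ?tpermL ?tpermR //.
  by case/andP: (fo x xu xv) => h1 h2; rewrite tpermD 1?eq_sym.
move: a; rewrite /adjacent => a.
case: (tpermP u v x) => [->|->|/eqP xu /eqP xv]; rewrite ?fv ?fu; try lia.
case/andP: (fo x xu xv) => /ord_neq h1 /ord_neq h2.
move: xu xv => /ord_neq xu /ord_neq xv.
by case: (tpermP u v y) => [->|->|_ _]; rewrite ?fv ?fu; try lia; exact: nc.
Qed.

Definition joined u v f : 'I_m -> 'I_m := fun x =>
  if (x == u) || (x == v) then x else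
  if f x == u then f v else if f x == v then f u else f x.

(** No point lies between [u] and [v], so the arcs leaving them can be merged into one arc from
    [f u] to [f v] running alongside the old ones. *)
Lemma noncrossing_joined f u v : noncrossing f -> adjacent u v ->
  f u != u -> f v != v -> noncrossing (joined u v f).
Proof.
move=> ncf a fu fv; have [inv nc] := ncf; have nuv := adjacent_neq a.
have finj := inv_inj inv.
split=> [x|x y].
  rewrite {2}/joined; case: ifPn => [xuv|]; first by rewrite /joined xuv.
  rewrite negb_or => /andP[xu xv].
  have [fxu|fxu] := eqVneq (f x) u.
    have ex : x = f u by rewrite -fxu inv.
    rewrite /joined inv eqxx (negPf fv) (eq_sym v u) (negPf nuv) orbF.
    case: ifP => [/eqP e|_] //; move: xv; by rewrite ex -e inv eqxx.
  have [fxv|fxv] := eqVneq (f x) v.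
    have ex : x = f v by rewrite -fxv inv.
    rewrite /joined inv eqxx (negPf fu) orFb.
    case: ifP => [/eqP e|_] //; move: xu; by rewrite ex -e inv eqxx.
  by rewrite /joined inv (negPf fxu) (negPf fxv) (negPf xu) (negPf xv).
move: a; rewrite /adjacent => a; rewrite /joined.
have [_|] := boolP ((x == u) || (x == v)); first lia.
rewrite negb_or => /andP[xu xv].
have b1 := @noncrossing_between f u y ncf; have b2 := @noncrossing_between f u (f y) ncf.
have b3 := @noncrossing_between f v y ncf; have b4 := @noncrossing_between f v (f y) ncf.
rewrite !inv in b2 b4.
have [//|] := boolP ((y == u) || (y == v)).
rewrite negb_or => /andP[yu yv].
have yu' := ord_neq yu; have yv' := ord_neq yv.
have xu' := ord_neq xu; have xv' := ord_neq xv.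
have nfy z : f y != z -> (y : nat) <> f z.
  by move=> h /val_inj e; move: h; rewrite e inv eqxx.
have [fxu|fxu] := eqVneq (f x) u.
  have ex : x = f u by rewrite -fxu inv.
  have [fyu|fyu] := eqVneq (f y) u; first by rewrite -fyu inv in ex; rewrite ex; lia.
  have [fyv|fyv] := eqVneq (f y) v.
    have -> : y = f v by rewrite -fyv inv.
    by lia.
  have n1 := nfy _ fyu; have n2 := nfy _ fyv.
  have n3 := ord_neq fyu; have n4 := ord_neq fyv.
  have n5 : (f y : nat) <> f u by move=> /val_inj /finj e; move: yu; rewrite e eqxx.
  have n6 : (f y : nat) <> f v by move=> /val_inj /finj e; move: yv; rewrite e eqxx.
  rewrite ex => h; clear - a b1 b2 b3 b4 n1 n2 n3 n4 n5 n6 h yu' yv'; lia.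
have [fxv|fxv] := eqVneq (f x) v.
  have ex : x = f v by rewrite -fxv inv.
  have [fyu|fyu] := eqVneq (f y) u.
    have -> : y = f u by rewrite -fyu inv.
    by lia.
  have [fyv|fyv] := eqVneq (f y) v; first by rewrite -fyv inv in ex; rewrite ex; lia.
  have n1 := nfy _ fyu; have n2 := nfy _ fyv.
  have n3 := ord_neq fyu; have n4 := ord_neq fyv.
  have n5 : (f y : nat) <> f u by move=> /val_inj /finj e; move: yu; rewrite e eqxx.
  have n6 : (f y : nat) <> f v by move=> /val_inj /finj e; move: yv; rewrite e eqxx.
  rewrite ex => h; clear - a b1 b2 b3 b4 n1 n2 n3 n4 n5 n6 h yu' yv'; lia.
clear b1 b2 b3 b4; have fxu' := ord_neq fxu; have fxv' := ord_neq fxv.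
move=> /nc h.
have [fyu|fyu] := eqVneq (f y) u.
  by rewrite fyu in h; apply: nc; lia.
have [fyv|fyv] := eqVneq (f y) v.
  by rewrite fyv in h; apply: nc; lia.
exact: h.
Qed.

End Noncrossing.

(** * Words compatible with a diagram *)

Section Compatibility.
Variable m : nat.
Implicit Types (f : 'I_m -> 'I_m) (d : 'I_m -> bool) (u v x y z : 'I_m).
Implicit Types (X Y : {set 'I_m} * {set 'I_m}) (s : seq 'I_m).

(* The pair (f, d) encodes a noncrossing diagram: arcs join x to f x, and a   *)
(* fixed point x of f lies in both sets if d x and in neither otherwise.      *)
Definition compat_at f d X x : bool :=
  if f x == x then ((x \in X.1) == d x) && ((x \in X.2) == d x)
  else ((x \in X.2) == (x \notin X.1)) && ((f x \in X.1) == (x \notin X.1)).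

Definition compat f d X : bool := [forall x, compat_at f d X x].

Lemma compat_split f d X s : compat f d X =
  all (compat_at f d X) s && [forall (x | x \notin s), compat_at f d X x].
Proof.
apply/forallP/andP => [h|[/allP h1 /forall_inP h2] x].
  by split; [apply/allP => x _|apply/forall_inP => x _]; exact: h.
by have [/h1|/h2] := boolP (x \in s).
Qed.

Lemma compat_rest f d X f' d' X' s :
  (forall x, x \notin s -> compat_at f d X x = compat_at f' d' X' x) ->
  [forall (x | x \notin s), compat_at f d X x] =
  [forall (x | x \notin s), compat_at f' d' X' x].
Proof.
by move=> h; apply: eq_forallb => x; have [//|/h->] := boolP (x \in s).
Qed.

Lemma compat_bal f d X x : involutive f -> compat f d X ->
  if f x == x then bal X x = 0 else bal X (f x) = - bal X x.
Proof.
move=> inv /forallP h; have hx := h x; rewrite /compat_at in hx.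
case: ifP hx => [_ /andP[/eqP e1 /eqP e2]|fx /andP[/eqP e1 /eqP e2]].
  by rewrite balE e1 e2 subrr.
have := h (f x); rewrite /compat_at inv eq_sym fx => /andP[/eqP e3 _].
by rewrite !balE e3 e2 e1; case: (x \in _).
Qed.

(** On a window stable under [f], reindexing by [f] negates the sum of balances, which is therefore
    0. *)
Lemma compat_height f d X (a b : nat) : involutive f -> compat f d X ->
  (a <= b)%N -> (forall x, (a <= f x < b)%N = (a <= x < b)%N) ->
  height X b = height X a.
Proof.
move=> inv c ab fab; apply/eqP; rewrite -subr_eq0 heightB //.
set S := (X in X == 0); suff : S = - S by lia.
rewrite {1}/S (reindex_inj (inv_inj inv)) /= /S -sumrN.
apply: eq_big => // x _; have := compat_bal x inv c.
by case: eqP => [->|_] // ->; rewrite oppr0.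
Qed.

(** For an arc, the window with its ends and the window without them are both stable under [f], so X
    has height change 0 across each. Dominance, which applies because 0 is even, transfers both
    equalities to Y, and their difference says that Y has opposite balances at the two ends. *)
Lemma compat_dominance f d X Y : noncrossing f -> compat f d X ->
  height_dominance X Y -> compat f d Y.
Proof.
move=> [inv nc] c [e h]; apply/forallP => x; rewrite /compat_at.
have [fx|fx] := eqVneq (f x) x.
  have /forallP/(_ x) := c; rewrite /compat_at fx eqxx; have := e x.
  by do 4 case: (x \in _); case: (d x).
have eqh a b : height X a = height X b -> height Y a = height Y b.
  move=> eab; have := h b a; rewrite eab subrr normr0 => /(_ isT).
  by rewrite normr_le0 subr_eq0 => /eqP.
have key y : (y < f y)%N -> bal Y y + bal Y (f y) = 0.
  move=> yf.
  have nc' z : (y < z < f y)%N = (y < f z < f y)%N.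
    by apply/idP/idP => [/nc//|/nc]; rewrite inv.
  have e1 : height X (f y).+1 = height X y.
    apply: (compat_height inv c); first lia.
    move=> z; have [->|zy] := eqVneq z y; first by lia.
    have [->|zfy] := eqVneq z (f y); first by rewrite inv; lia.
    have := nc' z; have := ord_neq zy; have := ord_neq zfy.
    have : (f z : nat) <> f y by move=> /val_inj /(inv_inj inv) ez; rewrite ez eqxx in zy.
    have : (f z : nat) <> y by move=> /val_inj ez; rewrite -ez inv eqxx in zfy.
    lia.
  have e2 : height X (f y) = height X y.+1.
    apply: (compat_height inv c); first lia.
    by move=> z; exact/esym/nc'.
  have := eqh _ _ e1; rewrite heightS (eqh _ _ e2) heightS => e3.
  by lia.
have bxf : bal Y x + bal Y (f x) = 0.
  have [|fxx|/val_inj ex] := ltngtP x (f x); first exact: key.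
    by rewrite addrC -{2}(inv x); apply: key; rewrite inv.
  by rewrite -ex eqxx in fx.
have bx : bal Y x != 0.
  rewrite (multeq_bal0 _ e) balE; have /forallP/(_ x) := c.
  by rewrite /compat_at (negPf fx); do 2 case: (x \in _).
move: bx bxf; rewrite !balE.
by do 2 case: (x \in _); do 2 case: (f x \in _).
Qed.

End Compatibility.

(** * The cone spanned by compatibility indicators *)

Section Cone.
Variables (R : realType) (m : nat).
Implicit Types (f : 'I_m -> 'I_m) (d : 'I_m -> bool) (u v x y z : 'I_m).
Implicit Types (X Y : {set 'I_m} * {set 'I_m}).
Implicit Types (g h : {set 'I_m} * {set 'I_m} -> R).

(* The products of two minors of a totally nonnegative matrix will be shown   *)
(* to lie in this cone; the coefficients are its Temperley-Lieb immanants.    *)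
Inductive diagram_cone : ({set 'I_m} * {set 'I_m} -> R) -> Prop :=
| cone_zero g : (forall X, g X = 0) -> diagram_cone g
| cone_cons a f d h g : 0 <= a -> noncrossing f -> diagram_cone h ->
    (forall X, g X = a * (compat f d X)%:R + h X) -> diagram_cone g.

Lemma cone_ext g h : diagram_cone g -> (forall X, h X = g X) -> diagram_cone h.
Proof.
case=> [g' g0|a f d h' g' a0 nc ch hg] e.
  by apply: cone_zero => X; rewrite e g0.
by apply: (cone_cons (f := f) (d := d) a0 nc ch) => X; rewrite e hg.
Qed.

Lemma cone_add g h : diagram_cone g -> diagram_cone h ->
  diagram_cone (fun X => g X + h X).
Proof.
move=> cg ch; elim: cg => {g} [g g0|a f d g' g a0 nc _ IH hg].
  by apply: cone_ext ch _ => X; rewrite g0 add0r.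
by apply: (cone_cons (f := f) (d := d) a0 nc IH) => X; rewrite hg addrA.
Qed.

Lemma cone_scale g c : 0 <= c -> diagram_cone g -> diagram_cone (fun X => c * g X).
Proof.
move=> c0 cg; elim: cg => {g} [g g0|a f d g' g a0 nc _ IH hg].
  by apply: cone_zero => X; rewrite g0 mulr0.
apply: (cone_cons (a := c * a) (f := f) (d := d) _ nc IH); first exact: mulr_ge0.
by move=> X; rewrite hg mulrDr mulrA.
Qed.

Lemma cone_compat f d : noncrossing f -> diagram_cone (fun X => (compat f d X)%:R).
Proof.
move=> nc; apply: (cone_cons (a := 1) (f := f) (d := d) (h := fun=> 0)) => //.
  by apply: cone_zero.
by move=> X; rewrite mul1r addr0.
Qed.

Lemma cone_dominance g X Y : diagram_cone g -> height_dominance X Y -> g X <= g Y.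
Proof.
move=> cg hXY; elim: cg => {g} [g g0|a f d g' g a0 nc _ IH hg].
  by rewrite !g0.
rewrite !hg lerD // ler_wpM2l // ler_nat.
by have [/(compat_dominance nc)->|] := boolP (compat f d X).
Qed.

(** The effect on products of coordinates of scaling a row ([b] false) or a column ([b] true) by
    0. *)
Definition restrict b x g X : R :=
  if ((x \in X.1) == b) && ((x \in X.2) == b) then g X else 0.

Lemma cone_restrict b x g : diagram_cone g -> diagram_cone (restrict b x g).
Proof.
elim=> {g} [g g0|a f d g' g a0 nc _ IH hg].
  by apply: cone_zero => X; rewrite /restrict g0 if_same.
have [/andP[fx dx]|fdx] := boolP ((f x == x) && (d x == b)).
  apply: (cone_cons (f := f) (d := d) a0 nc IH) => X; rewrite /restrict hg.
  case: ifPn => // hX; have -> : compat f d X = false.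
    apply: contraNF hX => /forallP/(_ x); rewrite /compat_at fx.
    by rewrite (eqP dx).
  by rewrite mulr0 addr0.
apply: cone_ext IH _ => X; rewrite /restrict hg; case: ifP => // hX.
have -> : compat f d X = false; last by rewrite mulr0 add0r.
apply: contraNF fdx => /forallP/(_ x); rewrite /compat_at.
move: hX; case: (f x == x); case: (x \in X.1); case: (x \in X.2); by case: (b); case: (d x).
Qed.

(** [move_one] and [move_two] are the coefficients of [t] and [t ^+ 2] produced by a move, as
    operators on functions of pairs of sets. *)
Definition move_one u v g X : R :=
  (if acts u v X.1 then g (replace_elt u v X.1, X.2) else 0) +
  (if acts u v X.2 then g (X.1, replace_elt u v X.2) else 0).

Definition move_two u v g X : R :=
  if acts u v X.1 && acts u v X.2 then g (set_op u v X) else 0.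

End Cone.

Section ConeMoves.
Variables (R : realType) (m : nat).
Implicit Types (f : 'I_m -> 'I_m) (d : 'I_m -> bool) (u v x y z : 'I_m).
Implicit Types (X Y : {set 'I_m} * {set 'I_m}).
Implicit Types (g h : {set 'I_m} * {set 'I_m} -> R).

Lemma in_replace_other u v x (Z : {set 'I_m}) : x != u -> x != v ->
  (x \in replace_elt u v Z) = (x \in Z).
Proof. by move=> /negPf xu /negPf xv; rewrite in_replace_elt xu xv if_same. Qed.

Definition moved_pair (b : bool * bool) u v X :=
  (if b.1 then replace_elt u v X.1 else X.1, if b.2 then replace_elt u v X.2 else X.2).

Lemma in_moved_pair_other b u v x X : x != u -> x != v ->
  (x \in (moved_pair b u v X).1) = (x \in X.1) /\
  (x \in (moved_pair b u v X).2) = (x \in X.2).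
Proof.
by move=> xu xv; case: b => -[] [] /=; rewrite ?in_replace_other.
Qed.

(** Localization: away from the positions in [s] nothing changes, so each computation below is a
    finite check on membership at these positions. *)
Lemma compat_moved b f d f' d' u v X s :
  (forall x, x \notin s -> [/\ x != u, x != v, f x != u & f x != v] /\ f' x = f x /\ d' x = d x) ->
  compat f d (moved_pair b u v X) =
  all (compat_at f d (moved_pair b u v X)) s &&
  [forall (x | x \notin s), compat_at f' d' X x].
Proof.
move=> h; rewrite (compat_split _ _ _ s); congr (_ && _); apply: compat_rest => x /h.
case=> -[xu xv fxu fxv] [fx dx]; rewrite /compat_at fx dx.
have [-> ->] := in_moved_pair_other b X xu xv.
by have [-> _] := in_moved_pair_other b X fxu fxv.
Qed.

Lemma move_oneE f d u v X : move_one u v (fun X => (compat f d X)%:R : R) X =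
  (acts u v X.1 && compat f d (moved_pair (true, false) u v X))%:R +
  (acts u v X.2 && compat f d (moved_pair (false, true) u v X))%:R.
Proof. by rewrite /move_one; case: ifP => _; case: ifP. Qed.

Lemma move_twoE f d u v X : move_two u v (fun X => (compat f d X)%:R : R) X =
  (acts u v X.1 && acts u v X.2 && compat f d (moved_pair (true, true) u v X))%:R.
Proof. by rewrite /move_two; case: ifP => _. Qed.

Lemma move_one_pair f d u v X : involutive f -> u != v ->
  f u = u -> f v = v -> d u = false -> d v = true ->
  move_one u v (fun X => (compat f d X)%:R : R) X =
  (compat (fun x => f (tperm u v x)) d X)%:R.
Proof.
move=> inv /[dup] /negPf uv; rewrite eq_sym => /negPf vu fu fv du dv.
have h x : x \notin [:: u; v] -> [/\ x != u, x != v, f x != u & f x != v] /\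
    f (tperm u v x) = f x /\ d x = d x.
  rewrite !inE negb_or => /andP[xu xv]; split; last split=> //; first split=> //.
  - by apply: contraNneq xu => e; rewrite -(inv x) e fu.
  - by apply: contraNneq xv => e; rewrite -(inv x) e fv.
  - by rewrite tpermD // eq_sym.
rewrite move_oneE !(compat_moved _ _ h) (compat_split _ _ _ [:: u; v]).
move: [forall (x | _), _] => r.
rewrite /= /compat_at fu fv tpermL tpermR fu fv !eqxx uv vu du dv /=.
rewrite !in_replace_elt /acts !eqxx uv vu.
by do 2 case: (u \in _); do 2 case: (v \in _); case: r => //=; lra.
Qed.

Lemma swapped_rest f d u v w x : involutive f -> f u = u \/ f v = v ->
  (w == u) || (w == v) -> f w != w ->
  x \notin [:: u; v; f w] ->
  [/\ x != u, x != v, f x != u & f x != v] /\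
  swapped u v f x = f x /\ d (tperm u v x) = d x.
Proof.
move=> inv fuv wuv fw; rewrite !inE !negb_or => /and3P[xu xv xw].
have fxu : f x != u.
  apply: contraNneq xw => e; have ex : x = f u by rewrite -e inv.
  case: fuv => e'; first by rewrite ex e' eqxx in xu.
  case/orP: wuv => /eqP ew; first by rewrite ew ex.
  by rewrite ew e' eqxx in fw.
have fxv : f x != v.
  apply: contraNneq xw => e; have ex : x = f v by rewrite -e inv.
  case: fuv => e'; last by rewrite ex e' eqxx in xv.
  case/orP: wuv => /eqP ew; last by rewrite ew ex.
  by rewrite ew e' eqxx in fw.
by rewrite /swapped (@tpermD _ u v x) 1?eq_sym // tpermD 1?eq_sym.
Qed.

Lemma move_one_swap0 f d u v X : involutive f -> u != v ->
  f u = u -> d u = false -> f v != v ->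
  move_one u v (fun X => (compat f d X)%:R : R) X =
  (compat (swapped u v f) (fun x => d (tperm u v x)) X)%:R.
Proof.
move=> inv /[dup] /negPf uv; rewrite eq_sym => /negPf vu fu du fv.
have h x : x \notin [:: u; v; f v] -> [/\ x != u, x != v, f x != u & f x != v] /\
    swapped u v f x = f x /\ d (tperm u v x) = d x.
  by apply: swapped_rest; rewrite ?eqxx ?orbT; auto.
have fvu : f v == u = false.
  by apply/negP => /eqP e; move: uv; rewrite -(inv v) e fu eqxx.
have ufv : u == f v = false by rewrite eq_sym.
have vfv : v == f v = false by rewrite eq_sym (negPf fv).
rewrite move_oneE !(compat_moved (d' := fun x => d (tperm u v x)) _ _ h).
rewrite (compat_split _ _ _ [:: u; v; f v]); move: [forall (x | _), _] => r.
have c1 : swapped u v f u = f v by rewrite /swapped tpermL tpermD // eq_sym ?fvu ?vfv.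
have c2 : swapped u v f v = v by rewrite /swapped tpermR fu tpermL.
have c3 : swapped u v f (f v) = u.
  by rewrite /swapped (@tpermD _ u v (f v)) ?inv ?tpermR // ?ufv ?vfv.
rewrite /= /compat_at c1 c2 c3 inv tpermR fu du !eqxx (negPf fv) vfv ufv fvu /=.
rewrite !in_replace_elt /acts !eqxx uv vu (negPf fv) fvu.
by do 2 case: (u \in _); do 2 case: (v \in _); do 2 case: (f v \in _); case: r;
   rewrite //= ?addr0 ?add0r.
Qed.

Lemma move_one_swap2 f d u v X : involutive f -> u != v ->
  f v = v -> d v = true -> f u != u ->
  move_one u v (fun X => (compat f d X)%:R : R) X =
  (compat (swapped u v f) (fun x => d (tperm u v x)) X)%:R.
Proof.
move=> inv /[dup] /negPf uv; rewrite eq_sym => /negPf vu fv dv fu.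
have h x : x \notin [:: u; v; f u] -> [/\ x != u, x != v, f x != u & f x != v] /\
    swapped u v f x = f x /\ d (tperm u v x) = d x.
  by apply: swapped_rest; rewrite ?eqxx ?orbT; auto.
have fuv : f u == v = false.
  by apply/negP => /eqP e; move: uv; rewrite -(inv u) e fv eqxx.
have vfu : v == f u = false by rewrite eq_sym.
have ufu : u == f u = false by rewrite eq_sym (negPf fu).
rewrite move_oneE !(compat_moved (d' := fun x => d (tperm u v x)) _ _ h).
rewrite (compat_split _ _ _ [:: u; v; f u]); move: [forall (x | _), _] => r.
have c1 : swapped u v f u = u by rewrite /swapped tpermL fv tpermR.
have c2 : swapped u v f v = f u by rewrite /swapped tpermR tpermD // eq_sym ?fuv ?ufu.
have c3 : swapped u v f (f u) = v.
  by rewrite /swapped (@tpermD _ u v (f u)) ?inv ?tpermL // ?ufu ?vfu.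
rewrite /= /compat_at c1 c2 c3 inv tpermL fv dv !eqxx (negPf fu) vfu ufu fuv /=.
rewrite !in_replace_elt /acts !eqxx uv vu (negPf fu) fuv.
by do 2 case: (u \in _); do 2 case: (v \in _); do 2 case: (f u \in _); case: r;
   rewrite //= ?addr0 ?add0r.
Qed.

(** The colours before a move that takes an element from [u] to [v]: [u] doubly occupied and [v]
    empty. *)
Definition emptied u v d : 'I_m -> bool :=
  fun x => if x == u then true else if x == v then false else d x.

Lemma joined_rest f d u v x : involutive f -> f u != u -> f v != v ->
  x \notin [:: u; v; f u; f v] ->
  [/\ x != u, x != v, f x != u & f x != v] /\
  joined u v f x = f x /\ emptied u v d x = d x.
Proof.
move=> inv fu fv; rewrite !inE !negb_or => /and4P[xu xv xfu xfv].
have fxu : f x != u by apply: contraNneq xfu => <-; rewrite inv.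
have fxv : f x != v by apply: contraNneq xfv => <-; rewrite inv.
by rewrite /joined /emptied (negPf xu) (negPf xv) (negPf fxu) (negPf fxv).
Qed.

(** Starting from a doubly occupied [u] and an empty [v], moving either copy gives opposite letters
    at [u] and [v]. Both choices fit the arc, whence the factor 2. *)
Lemma move_one_cap f d u v X : involutive f -> u != v -> f u = v ->
  move_one u v (fun X => (compat f d X)%:R : R) X =
  2%:R * (compat (joined u v f) (emptied u v d) X)%:R.
Proof.
move=> inv /[dup] /negPf uv; rewrite eq_sym => /negPf vu fu.
have fv : f v = u by rewrite -fu inv.
have h x : x \notin [:: u; v; f u; f v] -> [/\ x != u, x != v, f x != u & f x != v] /\
    joined u v f x = f x /\ emptied u v d x = d x.
  by apply: joined_rest; rewrite ?fu ?fv ?uv ?vu.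
rewrite move_oneE !(compat_moved _ _ h) (compat_split _ _ _ [:: u; v; f u; f v]).
move: [forall (x | _), _] => r.
rewrite fu fv /= /compat_at /joined /emptied fu fv !eqxx uv vu /=.
rewrite !in_replace_elt /acts !eqxx uv vu.
by do 2 case: (u \in _); do 2 case: (v \in _); case: r => //=; lra.
Qed.

(** Here the letters at [f u] and [f v] prescribe which of the two copies must move, so exactly one
    choice contributes, and these letters must be opposite. *)
Lemma move_one_join f d u v X : involutive f -> u != v ->
  f u != u -> f v != v -> f u != v ->
  move_one u v (fun X => (compat f d X)%:R : R) X =
  (compat (joined u v f) (emptied u v d) X)%:R.
Proof.
move=> inv /[dup] /negPf uv; rewrite eq_sym => /negPf vu fu fv fuv.
have h x : x \notin [:: u; v; f u; f v] -> [/\ x != u, x != v, f x != u & f x != v] /\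
    joined u v f x = f x /\ emptied u v d x = d x.
  exact: joined_rest.
have fvu : f v != u by apply: contraNneq fuv => <-; rewrite inv.
have fufv : f u == f v = false by rewrite (inj_eq (inv_inj inv)).
have fvfu : f v == f u = false by rewrite eq_sym.
rewrite move_oneE !(compat_moved _ _ h) (compat_split _ _ _ [:: u; v; f u; f v]).
move: [forall (x | _), _] => r.
rewrite /= /compat_at /joined /emptied !inv !eqxx ?uv ?vu.
rewrite !(eq_sym u (f _)) !(eq_sym v (f _)).
rewrite (negPf fu) (negPf fv) (negPf fuv) (negPf fvu) fufv fvfu /=.
rewrite !in_replace_elt /acts !eqxx ?uv ?vu (negPf fu) (negPf fv) (negPf fuv) (negPf fvu) /=.
move: (u \in X.1) (u \in X.2) (v \in X.1) (v \in X.2) => u1 u2 v1 v2.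
move: (f u \in X.1) (f u \in X.2) (f v \in X.1) (f v \in X.2) => a1 a2 b1 b2.
by case: u1; case: u2; case: v1; case: v2; rewrite /= ?andbF ?addr0 //;
   case: a1; case: a2; case: b1; case: b2; case: r; rewrite //= ?addr0 ?add0r.
Qed.

End ConeMoves.

Section ConeClosure.
Variables (R : realType) (m : nat).
Implicit Types (f : 'I_m -> 'I_m) (d : 'I_m -> bool) (u v x y z : 'I_m).
Implicit Types (X Y : {set 'I_m} * {set 'I_m}).
Implicit Types (g h : {set 'I_m} * {set 'I_m} -> R).

Lemma move_one_zero f d u v X : u != v ->
  (f u = u /\ d u = true) \/ (f v = v /\ d v = false) ->
  move_one u v (fun X => (compat f d X)%:R : R) X = 0.
Proof.
move=> /[dup] /negPf uv; rewrite eq_sym => /negPf vu.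
rewrite move_oneE !(compat_split _ _ _ [:: u; v]).
do 2 move: [forall (x | _), _] => ?.
case=> -[fx dx]; rewrite /= /compat_at fx dx !eqxx !in_replace_elt /acts !eqxx ?uv ?vu /=.
  by do 2 case: (u \in _); do 2 case: (v \in _); rewrite //= ?andbF ?addr0.
by do 2 case: (u \in _); do 2 case: (v \in _); rewrite //= ?andbF ?addr0.
Qed.

Lemma move_two_pair f d u v X : involutive f -> u != v ->
  f u = u -> f v = v -> d u = false -> d v = true ->
  move_two u v (fun X => (compat f d X)%:R : R) X =
  (compat f (emptied u v d) X)%:R.
Proof.
move=> inv /[dup] /negPf uv; rewrite eq_sym => /negPf vu fu fv du dv.
have h x : x \notin [:: u; v] -> [/\ x != u, x != v, f x != u & f x != v] /\
    f x = f x /\ emptied u v d x = d x.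
  rewrite !inE negb_or => /andP[xu xv]; split; first split=> //.
  - by apply: contraNneq xu => e; rewrite -(inv x) e fu.
  - by apply: contraNneq xv => e; rewrite -(inv x) e fv.
  - by rewrite /emptied (negPf xu) (negPf xv).
rewrite move_twoE !(compat_moved _ _ h) (compat_split _ _ _ [:: u; v]).
move: [forall (x | _), _] => r.
rewrite /= /compat_at fu fv /emptied !eqxx ?vu du dv /=.
rewrite !in_replace_elt /acts !eqxx ?uv ?vu /=.
by do 2 case: (u \in _); do 2 case: (v \in _); case: r.
Qed.

Lemma move_two_zero f d u v X : u != v ->
  ~~ [&& f u == u, f v == v, ~~ d u & d v] ->
  move_two u v (fun X => (compat f d X)%:R : R) X = 0.
Proof.
move=> /[dup] /negPf uv; rewrite eq_sym => /negPf vu.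
rewrite move_twoE !(compat_split _ _ _ [:: u; v]).
move: [forall (x | _), _] => ?.
rewrite /= /compat_at !in_replace_elt /acts !eqxx ?uv ?vu /=.
case: (f u == u); case: (f v == v); case: (d u); case: (d v) => //= _;
by do 2 case: (u \in _); do 2 case: (v \in _); rewrite //= ?andbF.
Qed.

(** A single diagram is sent to 0 or to a positive multiple of one diagram, according to whether [u]
    and [v] are isolated or ends of arcs. *)
Lemma cone_move_one u v g : adjacent u v -> diagram_cone g -> diagram_cone (move_one u v g).
Proof.
move=> a; have uv := adjacent_neq a; elim=> {g} [g g0|c f d g' g c0 nc _ IH hg].
  by apply: cone_zero => X; rewrite /move_one !g0 !if_same addr0.
have [inv _] := nc.
suff /(cone_scale c0) cm : diagram_cone (move_one u v (fun X => (compat f d X)%:R : R)).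
  apply: cone_ext (cone_add cm IH) _ => X; rewrite /move_one !hg.
  by case: ifP => _; case: ifP => _; ring.
have [fu|fu] := eqVneq (f u) u.
  have [du|/negbTE du] := boolP (d u).
    by apply: cone_zero => X; apply: move_one_zero; auto.
  have [fv|fv] := eqVneq (f v) v.
    have [dv|/negbTE dv] := boolP (d v); last first.
      by apply: cone_zero => X; apply: move_one_zero; auto.
    apply: cone_ext (cone_compat _ d (noncrossing_pair nc a fu fv)) _ => X.
    exact: move_one_pair.
  apply: cone_ext (cone_compat _ (fun x => d (tperm u v x)) (noncrossing_swapped nc a (or_introl fu))) _ => X.
  exact: move_one_swap0.
have [fv|fv] := eqVneq (f v) v.
  have [dv|/negbTE dv] := boolP (d v); last first.
    by apply: cone_zero => X; apply: move_one_zero; auto.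
  apply: cone_ext (cone_compat _ (fun x => d (tperm u v x)) (noncrossing_swapped nc a (or_intror fv))) _ => X.
  exact: move_one_swap2.
have cj := cone_compat R (emptied u v d) (noncrossing_joined nc a fu fv).
have [fuv|fuv] := eqVneq (f u) v.
  apply: cone_ext (cone_scale (ler0n R 2) cj) _ => X; exact: move_one_cap.
by apply: cone_ext cj _ => X; exact: move_one_join.
Qed.

Lemma cone_move_two u v g : adjacent u v -> diagram_cone g -> diagram_cone (move_two u v g).
Proof.
move=> a; have uv := adjacent_neq a; elim=> {g} [g g0|c f d g' g c0 nc _ IH hg].
  by apply: cone_zero => X; rewrite /move_two !g0 !if_same.
have [inv _] := nc.
suff /(cone_scale c0) cm : diagram_cone (move_two u v (fun X => (compat f d X)%:R : R)).
  apply: cone_ext (cone_add cm IH) _ => X; rewrite /move_two !hg.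
  by case: ifP => _; ring.
have [/and4P[/eqP fu /eqP fv /negbTE du dv]|no] :=
  boolP [&& f u == u, f v == v, ~~ d u & d v].
  apply: cone_ext (cone_compat _ (emptied u v d) nc) _ => X.
  exact: move_two_pair.
by apply: cone_zero => X; apply: move_two_zero.
Qed.

End ConeClosure.

(** * Products of coordinates and the cone *)

Section ConeMinors.
Variables (R : realType) (n : nat).
Implicit Types (A : 'M[R]_n).

Lemma cone_plucker_move A A' (u v : 'I_(n + n)) t : adjacent u v -> 0 <= t ->
  (forall Z, plucker A' Z = plucker A Z + t * moved A u v Z) ->
  diagram_cone (plucker_prod A) -> diagram_cone (plucker_prod A').
Proof.
move=> a t0 h c.
have c1 := cone_scale t0 (cone_move_one a c).
have c2 := cone_scale (exprn_ge0 2 t0) (cone_move_two a c).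
apply: cone_ext (cone_add c (cone_add c1 c2)) _ => X.
rewrite /plucker_prod !h /move_one /move_two /moved /set_op /=.
by case: (acts u v X.1); case: (acts u v X.2) => /=; ring.
Qed.

Lemma cone_plucker_row A i : diagram_cone (plucker_prod A) -> diagram_cone (plucker_prod (scalerow i 0 A)).
Proof.
move=> /(cone_restrict false (lshift n i)) c; apply: cone_ext c _ => X.
rewrite /restrict /plucker_prod !plucker_scalerow.
by do 2 case: (_ \in _); rewrite /= ?mul0r ?mulr0 ?mul1r.
Qed.

Lemma cone_plucker_col A i : diagram_cone (plucker_prod A) -> diagram_cone (plucker_prod (scalecol i 0 A)).
Proof.
move=> /(cone_restrict true (rev_ord (lshift n i))) c; apply: cone_ext c _ => X.
rewrite /restrict /plucker_prod !plucker_scalecol.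
by do 2 case: (_ \in _); rewrite /= ?mul0r ?mulr0 ?mul1r.
Qed.

Lemma noncrossing_id m : noncrossing (fun x : 'I_m => x).
Proof. by split=> // x y; lia. Qed.

Lemma plucker_zero (Z : {set 'I_(n + n)}) :
  plucker (0 : 'M[R]_n) Z = [forall x : 'I_(n + n), (x \in Z) == (n <= x)%N]%:R.
Proof.
have [/forallP h|h] := boolP [forall x : 'I_(n + n), (x \in Z) == (n <= x)%N].
  apply: plucker_top; last by move=> u v ev; rewrite (eqP (h u)) (eqP (h v)) ev; lia.
  have r0 : rowsof Z = set0.
    by apply/setP => i; rewrite !inE (eqP (h _)) /= leqNgt ltn_ord.
  have c0 : colsof Z = set0.
    by apply/setP => i; rewrite !inE (eqP (h _)) /=; have := ltn_ord i; lia.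
  by have := card_rowscols Z; rewrite r0 c0 !cards0 addn0.
have [e|ne] := eqVneq #|rowsof Z| #|colsof Z|; last by rewrite /plucker set_minor_neq.
have [e0|] := eqVneq #|rowsof Z| 0%N.
  case/forallP: h => x; case: (lshift_or_rev x) => -[i ->] /=.
    have := cards0_eq e0 => /setP/(_ i); rewrite !inE => ->.
    by rewrite leqNgt ltn_ord.
  have := cards0_eq (esym (etrans (esym e0) e)) => /setP/(_ i); rewrite !inE => /negbFE ->.
  by have := ltn_ord i; lia.
case ek: #|rowsof Z| => [//|k] _; rewrite ek in e.
rewrite /plucker (set_minor_enum_val _ ek (esym e)) (_ : mxsub _ _ _ = 0) ?det0 //.
by apply/matrixP => i j; rewrite !mxE.
Qed.

(** The zero matrix has only the empty minor nonzero, so the product is the indicator of the diagram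
    without arcs whose upper half is doubly occupied. *)
Lemma cone_plucker_zero : diagram_cone (plucker_prod (0 : 'M[R]_n)).
Proof.
apply: cone_ext (cone_compat R (fun x : 'I_(n + n) => (n <= x)%N) (@noncrossing_id _)) _.
move=> X; rewrite /plucker_prod !plucker_zero -natrM mulnb; congr (nat_of_bool _)%:R.
apply/andP/forallP => [[/forallP h1 /forallP h2] x|h].
  by rewrite /compat_at eqxx h1 h2.
by split; apply/forallP => x; have := h x; rewrite /compat_at eqxx => /andP[].
Qed.

End ConeMinors.

(** * Whitney elimination *)

Section Plucker3.
Variables (R : comPzRingType) (k : nat).
Implicit Types (rho : 'I_k -> 'I_k -> R) (a b c d : 'I_k -> R).

Definition rowdet rho : R := \det (\matrix_(l, h) rho l h).

Lemma rowdet_upd rho l b :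
  rowdet (upd rho l b) = \sum_h b h * cofactor (\matrix_(l, h) rho l h) l h.
Proof.
rewrite /rowdet (expand_det_row _ l); apply: eq_bigr => h _.
rewrite mxE /upd eqxx /cofactor; congr (_ * (_ * \det _)).
apply/matrixP => i j; rewrite !mxE.
by rewrite eq_sym (negPf (neq_lift _ _)).
Qed.

Lemma cramer rho b h :
  b h * rowdet rho = \sum_l rowdet (upd rho l b) * rho l h.
Proof.
under eq_bigr do rewrite rowdet_upd mulr_suml.
rewrite exchange_big /=; set M := \matrix_(l, h) rho l h.
transitivity (\sum_p b p * (\adj M *m M) p h).
  rewrite mul_adj_mx (bigD1 h) //= mxE eqxx mulr1n big1 ?addr0 // => p ph.
  by rewrite mxE (negPf ph) mulr0n mulr0.
apply: eq_bigr => p _; rewrite !mxE mulr_sumr; apply: eq_bigr => l _.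
by rewrite !mxE mulrA.
Qed.

Lemma rowdet_eq rho rho' : (forall l h, rho l h = rho' l h) -> rowdet rho = rowdet rho'.
Proof. by move=> e; congr (\det _); apply/matrixP => l h; rewrite !mxE. Qed.

Lemma rowdet_alternate rho i j : i != j -> rho i =1 rho j -> rowdet rho = 0.
Proof. by move=> ij e; apply: (determinant_alternate ij) => h; rewrite !mxE. Qed.

Lemma rowdet_linear rho j (I : finType) (F : I -> R) (b : I -> 'I_k -> R) :
  rowdet (upd rho j (fun h => \sum_l F l * b l h)) = \sum_l F l * rowdet (upd rho j (b l)).
Proof.
rewrite rowdet_upd; under eq_bigr do rewrite mulr_suml.
rewrite exchange_big /=; apply: eq_bigr => l _.
by rewrite rowdet_upd mulr_sumr; apply: eq_bigr => h _; rewrite mulrA.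
Qed.

(** The Grassmann-Pluecker exchange relation. Cramer's rule expands [b] in the rows of [M];
    replacing the last row accordingly leaves only the terms from rows [i] and [j], since any other
    row would occur twice. *)
Lemma plucker3 rho i j a b c d : i != j ->
  let om x y := rowdet (upd (upd rho i x) j y) in
  om a b * om c d = om b d * om a c + om c b * om a d.
Proof.
move=> ij om; pose M := upd (upd rho i c) j d.
have -> : om a b * om c d = \sum_l rowdet (upd M l b) * om a (M l).
  rewrite /om -rowdet_linear mulrC -/M.
  transitivity (\sum_(l : 'I_1) rowdet M * rowdet (upd (upd rho i a) j b)).
    by rewrite big_ord1.
  rewrite -rowdet_linear; apply: rowdet_eq => l h; rewrite /upd.
  by case: (l == j) => //; rewrite big_ord1 mulrC cramer.
rewrite (bigD1 i) //= (bigD1 j) 1?eq_sym //= big1 ?addr0 => [|l /andP[li lj]].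
  have -> : rowdet (upd M i b) = om b d.
    apply: rowdet_eq => l h; rewrite /M /upd; case: (eqVneq l j) => [->|_].
      by rewrite eq_sym (negPf ij).
    by case: (l == i).
   have -> : rowdet (upd M j b) = om c b.
    by apply: rowdet_eq => l h; rewrite /M /upd; case: (l == j).
  have -> : om a (M i) = om a c.
    by apply: rowdet_eq => l h; rewrite /M /upd; case: (l == j); rewrite ?(negPf ij) ?eqxx.
  suff -> : om a (M j) = om a d by [].
  by apply: rowdet_eq => l h; rewrite /M /upd; case: (l == j); rewrite ?eqxx.
rewrite [om a _](@rowdet_alternate _ l j) ?mulr0 // => h.
by rewrite /M /upd (negPf li) (negPf lj) eqxx.
Qed.

Lemma rowdet_swap rho i j a b : i != j ->
  rowdet (upd (upd rho i a) j b) = - rowdet (upd (upd rho i b) j a).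
Proof.
move=> ij; pose M := \matrix_(l, h) upd (upd rho i b) j a l h.
rewrite -mulN1r; transitivity (\det (tperm_mx i j *m M)).
  congr (\det _); rewrite -xrowE; apply/matrixP => l h; rewrite !mxE /upd.
  case: tpermP => [->|->|/eqP/negPf-> /eqP/negPf->]; rewrite ?eqxx ?(negPf ij) //.
by rewrite det_mulmx det_perm odd_tperm ij expr1.
Qed.

End Plucker3.

Section ThreeTerm.
Variables (R : comPzRingType) (m p : nat) (A : 'M[R]_(m, p)).

Definition sub_det k (r : 'I_k -> 'I_m) (c : 'I_k -> 'I_p) : R := \det (mxsub r c A).

Lemma eq_sub_det k (r r' : 'I_k -> 'I_m) (c c' : 'I_k -> 'I_p) : r =1 r' -> c =1 c' ->
  sub_det r c = sub_det r' c'.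
Proof. by move=> er ec; congr (\det _); apply/matrixP => i j; rewrite !mxE er ec. Qed.

Lemma rowdet_delta k (rho : 'I_k.+1 -> 'I_k.+1 -> R) i j y b : i != j ->
  rowdet (upd (upd rho i (fun h => (h == y)%:R)) j b) =
  (-1) ^+ (i + y) * \det (\matrix_(l, h) upd rho j b (lift i l) (lift y h)).
Proof.
move=> ij; rewrite /rowdet (expand_det_row _ i) (bigD1 y) //= big1 ?addr0 => [|h hy].
  rewrite mxE /upd (negPf ij) !eqxx mul1r /cofactor; congr (_ * \det _).
  apply/matrixP => l h; rewrite !mxE; case: (_ == j) => //.
  by rewrite eq_sym (negPf (neq_lift _ _)).
by rewrite mxE /upd (negPf ij) eqxx (negPf hy) mul0r.
Qed.

(** The relation [plucker3] with the unit vector at [y] as one of its four vectors: determinants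
    containing it are, up to sign, minors with column [y] and one row deleted. *)
Lemma three_term k (r : 'I_k.+1 -> 'I_m) (c : 'I_k.+1 -> 'I_p) (i j : 'I_k.+1) y q :
  j = i.+1 :> nat ->
  sub_det (r \o lift i) (c \o lift y) * sub_det (upd r j q) c =
  sub_det (upd r j q \o lift i) (c \o lift y) * sub_det r c +
  sub_det (r \o lift j) (c \o lift y) * sub_det (upd (upd r i (r j)) j q) c.
Proof.
move=> ji; have ij : i != j by rewrite -val_eqE /= ji; lia.
pose rho l h := A (r l) (c h); pose w x h := A x (c h).
pose e h : R := (h == y)%:R.
have := plucker3 rho e (w (r i)) (w (r j)) (w q) ij; cbv beta zeta.
rewrite (rowdet_swap _ (w (r j)) (w (r i)) ij).
have D1 x z : rowdet (upd (upd rho i (w x)) j (w z)) = sub_det (upd (upd r i x) j z) c.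
  by rewrite /rowdet /sub_det; congr (\det _); apply/matrixP => l h; rewrite !mxE /upd; case: (l == j); case: (l == i).
have D2 z : rowdet (upd (upd rho i e) j (w z)) =
    (-1) ^+ (i + y) * sub_det (upd r j z \o lift i) (c \o lift y).
  rewrite rowdet_delta //; congr (_ * \det _).
  by apply/matrixP => l h; rewrite !mxE /upd /=; case: (_ == j).
rewrite !D1 !D2.
have -> : sub_det (upd (upd r i (r i)) j q) c = sub_det (upd r j q) c.
  by apply: eq_sub_det => // l; rewrite /upd; case: (l == j) => //; case: eqP => [->|].
have -> : sub_det (upd (upd r i (r i)) j (r j)) c = sub_det r c.
  by apply: eq_sub_det => // l; rewrite /upd; case: eqP => [->|_] //; case: eqP => [->|].
have -> : sub_det (upd r j (r j) \o lift i) (c \o lift y) = sub_det (r \o lift i) (c \o lift y).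
  by apply: eq_sub_det => // l; rewrite /upd /=; case: eqP => [->|].
have -> : sub_det (upd r j (r i) \o lift i) (c \o lift y) = sub_det (r \o lift j) (c \o lift y).
  apply: eq_sub_det => // l; rewrite /upd /=; have [lj|lj] := eqVneq (lift i l) j.
    congr r; apply: val_inj => /=; move/(congr1 val): lj => /=.
    by rewrite /bump ji; lia.
  congr r; apply: val_inj => /=; move: lj; rewrite -val_eqE /= /bump ji; lia.
(* Since [j] is the successor of [i], all deletions carry the same sign [s], which cancels. *)
set s := (-1) ^+ _; have ss : s * s = 1 by rewrite -expr2 sqrr_sign.
move: (sub_det _ _) (sub_det _ _) (sub_det _ _) (sub_det r c) (sub_det _ _) (sub_det _ _) => a1 a2 a3 a4 a5 a6.
move=> h; rewrite -[LHS]mul1r -[RHS]mul1r -ss -!mulrA; congr (_ * _).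
by rewrite mulrDr [s * (a6 * a5)]mulrA h; ring.
Qed.

End ThreeTerm.

Section Whitney.
Variables (R : realType) (m : nat).
Implicit Types (A : 'M[R]_m) (p q cc : 'I_m).

Lemma sub_det_ge0 A k (r c : 'I_k -> 'I_m) : totally_nonnegative A -> incr r -> incr c ->
  0 <= sub_det A r c.
Proof. by move=> /totally_nonnegativeP tA hr hc; rewrite /sub_det -set_minor_incr. Qed.

Lemma tn_entry A i j : totally_nonnegative A -> 0 <= A i j.
Proof.
move=> tA; have := @sub_det_ge0 A 1 (fun=> i) (fun=> j) tA.
by rewrite /sub_det det_mx11 !mxE; apply=> a b; rewrite !ord1.
Qed.

Lemma incr_upd_next k (r : 'I_k -> 'I_m) i p q : incr r -> q = p.+1 :> nat ->
  r i = p -> (forall l, r l != q) -> incr (upd r i q).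
Proof.
by move=> hr qp ri nq; apply: incr_upd => //; rewrite ri /adjacent qp eqxx.
Qed.

Lemma incr_upd2 k (r : 'I_k -> 'I_m) (i j : 'I_k) p q : incr r ->
  j = i.+1 :> nat -> r j = p -> q = p.+1 :> nat -> (forall l, r l != q) ->
  incr (upd (upd r i p) j q).
Proof.
move=> hr ji rj qp nq a b ab.
have low (l : 'I_k) : (l < j)%N -> (r l < p)%N by move=> /hr; rewrite rj.
have high (l : 'I_k) : (j < l)%N -> (q < r l)%N.
  by move=> /hr; rewrite rj; have := nq l; rewrite -val_eqE /=; lia.
rewrite /upd; have [bj|bj] := eqVneq b j; have [aj|aj] := eqVneq a j.
- by move: ab; rewrite bj aj ltnn.
- have [_|ai] := eqVneq a i; first by rewrite qp.
  by rewrite qp ltnW // ltnS low // -bj.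
- have bi : b != i by rewrite -val_eqE /=; move: ab; rewrite aj ji; lia.
  by rewrite (negPf bi) high // -aj.
- have [bi|bi] := eqVneq b i.
    have [ai|ai] := eqVneq a i; first by move: ab; rewrite bi ai ltnn.
    by apply: low; move: ab; rewrite bi ji => /ltnW; rewrite ltnS.
  have [ai|ai] := eqVneq a i; last exact: hr.
  have jb : (j < b)%N by rewrite ltn_neqAle eq_sym bj ji -ai.
  by apply: leq_trans (high _ jb); rewrite qp leqW.
Qed.

Lemma incr_cons k (r : 'I_k.+1 -> 'I_m) (x : 'I_m) : incr r -> (x < r ord0)%N ->
  incr (fun l : 'I_k.+2 => if unlift ord0 l is Some l' then r l' else x).
Proof.
move=> hr xr i j; case: unliftP => [i' ->|->]; case: unliftP => [j' ->|->] //=.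
  exact: hr.
move=> _; have [->//|j0] := eqVneq j' ord0.
by apply: ltn_trans xr _; apply: hr; move: j0; rewrite -val_eqE /=; lia.
Qed.

(* Induction on the number n of rows above p: the three-term relation removes *)
(* the row preceding p, and if p comes first one expands along column cc.     *)
Lemma whitney_minors A p q cc : totally_nonnegative A -> q = p.+1 :> nat ->
  (forall s : 'I_m, (q < s)%N -> A s cc = 0) ->
  (forall s j : 'I_m, (p <= s)%N -> (j < cc)%N -> A s j = 0) ->
  forall n k (i0 : 'I_k) (r c : 'I_k -> 'I_m), i0 = n :> nat -> incr r -> incr c ->
  r i0 = p -> (forall l, r l != q) ->
  A q cc * sub_det A r c <= A p cc * sub_det A (upd r i0 q) c.
Proof.
move=> tA qp below left.
have Age0 i j := tn_entry i j tA.
elim=> [|n IH] [|k] i0 r c ei hr hc rp nq; try by case: i0 ei {rp}.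
  have {ei} i00 : i0 = ord0 by apply: val_inj.
  have rgt l : l != i0 -> (q < r l)%N.
    move=> l0; have : (r i0 < r l)%N.
      by apply: hr; move: l0; rewrite i00 -val_eqE /=; lia.
    by have := nq l; rewrite -val_eqE rp /=; lia.
  have rge l : (p <= r l)%N.
    by have [->|/rgt] := eqVneq l i0; [rewrite rp|lia].
  have hr' : incr (upd r i0 q) := incr_upd_next hr qp rp nq.
  have [c0|c0|/val_inj c0] := ltngtP (c ord0) cc.
  - have zero (r' : 'I_k.+1 -> 'I_m) : (forall l, (p <= r' l)%N) -> sub_det A r' c = 0.
      move=> h; rewrite /sub_det (expand_det_col _ ord0) big1 // => l _.
      by rewrite mxE left ?mul0r.
    by rewrite !zero ?mulr0 // => l; rewrite /upd; case: eqP => // _; lia.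
  (* Prefixing row [p] and column [cc] gives a larger nonnegative minor. In column [cc] only the
     rows [p] and [q] can contribute, and the expansion is the desired difference. *)
  - have pq : (p < upd r i0 q ord0)%N by rewrite /upd i00 eqxx; lia.
    have := sub_det_ge0 tA (incr_cons hr' pq) (incr_cons hc c0); rewrite /sub_det.
    set M := mxsub _ _ A.
    have E1 : row' ord0 (col' ord0 M) = mxsub (upd r i0 q) c A.
      by apply/matrixP => l h; rewrite !mxE !liftK.
    have E2 : row' (lift ord0 ord0) (col' ord0 M) = mxsub r c A.
      apply/matrixP => l h; rewrite !mxE liftK; congr (A _ _).
      case: (unliftP ord0 (lift (lift ord0 ord0) l)) => [l' e|e].
        have ll : l' = l.
          by apply: val_inj; move/(congr1 val): e => /=; rewrite /bump /=; lia.
        have l0 : l' != i0.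
          rewrite i00 ll; apply/eqP => l0; move/(congr1 val): e.
          by rewrite l0 ll /= /bump.
        by rewrite /upd (negPf l0) ll.
      rewrite -rp i00; congr r; apply: val_inj; move/(congr1 val): e => /=.
      by rewrite /bump /=; lia.
    rewrite (expand_det_col _ ord0) (bigD1 ord0) //= (bigD1 (lift ord0 ord0)) //=.
    rewrite big1 ?addr0 => [|l /andP[]]; last first.
      case: (unliftP ord0 l) => [l' ->|-> //] _ l0.
      rewrite mxE liftK unlift_none /upd.
      have l'0 : l' != i0 by apply: contraNneq l0 => ->; rewrite i00.
      by rewrite (negPf l'0) below ?mul0r //; apply: rgt.
    rewrite /cofactor E1 E2 !mxE !unlift_none liftK /upd i00 eqxx addn0 expr0 mul1r.
    by rewrite /= /bump /= addn0 expr1 mulN1r mulrN subr_ge0.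
  (* Column [cc] is the first one used and is nonzero at most in the first row, so both sides share
     the same complementary minor and equality holds. *)
  - have zero (r' : 'I_k.+1 -> 'I_m) : (forall l, l != ord0 -> (q < r' l)%N) ->
        sub_det A r' c = A (r' ord0) cc * \det (mxsub (r' \o lift ord0) (c \o lift ord0) A).
      move=> h; rewrite /sub_det (expand_det_col _ ord0) (bigD1 ord0) //= big1 ?addr0.
        rewrite mxE c0 /cofactor addn0 expr0 mul1r; congr (_ * \det _).
        by apply/matrixP => i j; rewrite !mxE.
      by move=> l l0; rewrite mxE c0 below ?mul0r // h.
    rewrite !zero; last first.
    + by move=> l l0; rewrite rgt // i00.
    + by move=> l l0; rewrite /upd i00 (negPf l0) rgt // i00.
    rewrite -{1 2}i00 rp /upd i00 eqxx mulrCA.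
    suff -> : mxsub ((fun j => if j == ord0 then q else r j) \o lift ord0) (c \o lift ord0) A
       = mxsub (r \o lift ord0) (c \o lift ord0) A by [].
    by apply/matrixP => i j; rewrite !mxE.
have hr' : incr (upd r i0 q) := incr_upd_next hr qp rp nq.
have [->|Dn0] := eqVneq (sub_det A r c) 0; first by rewrite mulr0 mulr_ge0 // sub_det_ge0.
have ixk : (n < k.+1)%N by have := ltn_ord i0; lia.
pose ix := Ordinal ixk.
have i0x : ix != i0 by rewrite -val_eqE /= ei; lia.
(* A nonzero determinant has a nonzero cofactor in the row before [p]; being a minor of a totally
   nonnegative matrix it is positive, so the inequality may be multiplied by it. *)
have [y cy] : exists y, sub_det A (r \o lift ix) (c \o lift y) != 0.
  apply/existsP; apply: contraNT Dn0 => /existsPn h.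
  rewrite /sub_det (expand_det_row _ ix) big1 // => y _; rewrite /cofactor.
  have /eqP := negbNE (h y); rewrite /sub_det => e.
  rewrite (_ : row' _ _ = mxsub (r \o lift ix) (c \o lift y) A) ?e ?mulr0 //.
  by apply/matrixP => i j; rewrite !mxE.
have hrl := incr_lift ix hr; have hcl := incr_lift y hc.
have Zp_gt0 : 0 < sub_det A (r \o lift ix) (c \o lift y).
  by rewrite lt_neqAle eq_sym cy sub_det_ge0.
have [i1 i1e _] := unlift_some i0x.
have i1n : i1 = n :> nat.
  by move/(congr1 val): i1e; rewrite /= ei /bump; lia.
have := IH _ i1 _ _ i1n hrl hcl; rewrite /= -i1e => /(_ rp (fun l => nq _)).
have -> : sub_det A (upd (r \o lift ix) i1 q) (c \o lift y) =
          sub_det A (upd r i0 q \o lift ix) (c \o lift y).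
  by apply: eq_sub_det => // l; rewrite /upd /= i1e (inj_eq lift_inj).
have tt := three_term A r c y q (i := ix) (j := i0) ei.
rewrite rp in tt; move=> ih.
have h1 : 0 <= sub_det A (r \o lift i0) (c \o lift y) by rewrite sub_det_ge0 //; exact: incr_lift.
have h2 : 0 <= sub_det A (upd (upd r ix p) i0 q) c.
  by rewrite sub_det_ge0 //; apply: incr_upd2 => //; rewrite rp.
(* The three-term relation splits the right-hand side in two: induction bounds the first summand
   from below, the second is nonnegative. *)
rewrite -(ler_pM2l Zp_gt0) [X in _ <= X]mulrCA tt mulrDr.
apply: (le_trans (y := A p cc * (sub_det A (upd r i0 q \o lift ix) (c \o lift y) * sub_det A r c))).
  by rewrite mulrA [X in _ <= X]mulrA (mulrC _ (A q cc)) ler_wpM2r // sub_det_ge0.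
by rewrite lerDl !mulr_ge0.
Qed.

End Whitney.

Lemma det2 (R : comPzRingType) (M : 'M[R]_2) :
  \det M = M ord0 ord0 * M ord_max ord_max - M ord0 ord_max * M ord_max ord0.
Proof.
rewrite (expand_det_row _ ord0) !big_ord_recl big_ord0 addr0 /cofactor !det_mx11 !mxE.
rewrite /= expr0 expr1 mul1r mulN1r mulrN.
by congr (_ * M _ _ - M _ _ * M _ _); apply: val_inj.
Qed.

(** * Elimination steps that lower the support *)

Section Descent.
Variables (R : realType) (m : nat).
Implicit Types (A : 'M[R]_m) (p q cc : 'I_m).

Lemma tn_addrow A u v t : adjacent u v -> 0 <= t -> totally_nonnegative A ->
  totally_nonnegative (addrow u v t A).
Proof.
move=> a t0 /totally_nonnegativeP h; apply/totally_nonnegativeP => X Y.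
by rewrite set_minor_addrow // addr_ge0 // mulr_ge0 //; case: ifP.
Qed.

(** A minor is affected only if it uses row [q] but not row [p], and then its nonnegativity is the
    inequality [whitney_minors] divided by [A p cc]. *)
Lemma tn_eliminate A p q cc : totally_nonnegative A -> q = p.+1 :> nat ->
  (forall s : 'I_m, (q < s)%N -> A s cc = 0) ->
  (forall s j : 'I_m, (p <= s)%N -> (j < cc)%N -> A s j = 0) ->
  0 < A p cc -> totally_nonnegative (addrow q p (- (A q cc / A p cc)) A).
Proof.
move=> tA qp below left Ap; apply/totally_nonnegativeP => X Y.
have apq : adjacent p q by rewrite /adjacent qp eqxx.
have aqp : adjacent q p by rewrite /adjacent qp eqxx orbT.
rewrite set_minor_addrow // mulNr; case: ifP => [a|_]; last first.
  by rewrite mulr0 subr0; move/totally_nonnegativeP: tA.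
have [e|ne] := eqVneq #|X| #|Y|; last first.
  by rewrite !set_minor_neq ?card_replace_elt // mulr0 subr0.
have [k eY] : exists k, #|Y| = k by exists #|Y|.
rewrite eY in e; have [c hc hY] := set_incr eY.
have eX' : #|replace_elt q p X| = k by rewrite card_replace_elt.
have [r hr hX'] := set_incr eX'.
have memr x : reflect (exists i, x = r i) (x \in replace_elt q p X).
  by rewrite hX'; apply: (iffP imsetP) => [[i]|[i]]; exists i.
have [i0 rp] : exists i, p = r i.
  by apply/memr; rewrite in_replace_elt a eqxx.
have nq l : r l != q.
  apply/eqP => e1; have : q \in replace_elt q p X by apply/memr; exists l.
  rewrite in_replace_elt a eqxx /= orbF => /eqP /(congr1 val) /=; lia.
have hX : X = [set upd r i0 q i | i : 'I_k].
  apply/setP => x; apply/idP/imsetP => [xX|[i _ ->]].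
    have [->|xq] := eqVneq x q; first by exists i0 => //; rewrite /upd eqxx.
    have /memr[i xi] : x \in replace_elt q p X by rewrite in_replace_elt a xq xX orbT.
    exists i => //; rewrite /upd; case: eqP => // ii.
    by case/andP: a => _; rewrite rp -ii -xi xX.
  rewrite /upd; case: eqP => [_|/eqP ii]; first by case/andP: a.
  have : r i \in replace_elt q p X by apply/memr; exists i.
  rewrite in_replace_elt a (negPf (_ : r i != p)) ?nq //.
  by rewrite rp (inj_eq (incr_inj hr)).
have hru : incr (upd r i0 q) by apply: incr_upd => //; rewrite -rp.
rewrite {1}hX hX' hY !set_minor_incr // subr_ge0 mulrAC ler_pdivrMr // [X in _ <= X]mulrC.
exact: (whitney_minors tA qp below left erefl hr hc (esym rp) nq).
Qed.

(** The weights make this measure drop both when an entry is annihilated and when a nonzero row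
    moves up; the summand 1 lets every nonzero entry count. *)
Definition support_weight A : nat :=
  (\sum_i \sum_j (if A i j != 0%R then i + j + 1 else 0))%N.

Lemma ltn_sum_one (I : finType) (F G : I -> nat) (i0 : I) :
  (forall i, F i <= G i)%N -> (F i0 < G i0)%N -> (\sum_i F i < \sum_i G i)%N.
Proof.
move=> le lt; rewrite (bigD1 i0) //= [X in (_ < X)%N](bigD1 i0) //= -addSn.
by rewrite leq_add // leq_sum.
Qed.

Lemma ltn_support (A B : 'M[R]_m) (s : 'I_m -> 'I_m) i0 j0 : injective s ->
  (forall i j, A (s i) j != 0 -> B i j != 0 /\ (s i <= i)%N) ->
  B i0 j0 != 0 -> A (s i0) j0 = 0 \/ (s i0 < i0)%N ->
  (support_weight A < support_weight B)%N.
Proof.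
move=> injs h b0 a0; rewrite /support_weight (reindex_inj injs) /=.
have le i j : ((if A (s i) j != 0%R then s i + j + 1 else 0) <=
               (if B i j != 0%R then i + j + 1 else 0))%N.
  by case: ifP => // /h[-> ]; lia.
apply: (ltn_sum_one (i0 := i0)) => [i|]; first by apply: leq_sum => j _.
apply: (ltn_sum_one (i0 := j0)) => //; rewrite b0.
by case: a0 => [->|lt]; [rewrite eqxx /= addn1|case: ifP => _; rewrite /=; lia].
Qed.

(* Here cc is the first column with a nonzero entry below the diagonal, and q *)
(* the last row with a nonzero entry in it. If A p cc = 0 then row p vanishes *)
(* and row q is shifted up.                                                   *)
Lemma row_step A : totally_nonnegative A ->
  (exists i j : 'I_m, (j < i)%N /\ A i j != 0) ->
  exists A1, [/\ totally_nonnegative A1, (support_weight A1 < support_weight A)%N &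
    exists p q : 'I_m, adjacent q p /\
      ((exists2 t, 0 <= t & A = addrow q p t A1) \/
       A = scalerow p 0 (addrow q p 1 A1))].
Proof.
move=> tA [i1 [j1 [ij1 A1n]]].
pose P (j : 'I_m) := [exists i : 'I_m, (j < i)%N && (A i j != 0)].
have Pj1 : P j1 by apply/existsP; exists i1; rewrite ij1.
case: (arg_minnP (fun j : 'I_m => j : nat) Pj1) => cc /existsP[i2 /andP[ci2 Ai2]] minc.
case: (arg_maxnP (P := fun i : 'I_m => A i cc != 0) (fun i : 'I_m => i : nat) Ai2) => q Aq maxq.
have cq : (cc < q)%N by apply: leq_trans ci2 (maxq _ Ai2).
have pm : (q.-1 < m)%N by have := ltn_ord q; lia.
pose p := Ordinal pm.
have qp : q = p.+1 :> nat by rewrite /=; lia.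
have below (s : 'I_m) : (q < s)%N -> A s cc = 0.
  by move=> qs; apply/eqP; apply: contraTT qs => /maxq; rewrite -leqNgt.
have left (s j : 'I_m) : (p <= s)%N -> (j < cc)%N -> A s j = 0.
  move=> ps jc; have [//|As] := eqVneq (A s j) 0.
  have Pj : P j.
    by apply/existsP; exists s; rewrite As andbT; move: ps; rewrite /=; lia.
  by have := minc j Pj; rewrite leqNgt jc.
have aqp : adjacent q p by rewrite /adjacent qp eqxx orbT.
have apq : adjacent p q by rewrite /adjacent qp eqxx.
have pq : p != q := adjacent_neq apq.
have [Ap|Ap] := eqVneq (A p cc) 0; last first.
  have Ap0 : 0 < A p cc by rewrite lt_neqAle eq_sym Ap tn_entry.
  have tA1 := tn_eliminate tA qp below left Ap0.
  set t := A q cc / A p cc in tA1; have t0 : 0 <= t by rewrite divr_ge0 ?tn_entry.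
  exists (addrow q p (- t) A); split=> //.
    apply: (@ltn_support _ _ id q cc) => // [i j|]; last first.
      by left; rewrite mxE eqxx /t mulNr divfK ?subrr.
    (* No new nonzero entry appears: where row [q] was 0, the new entry is minus a nonnegative
       number, yet nonnegative. *)
    have := tn_entry i j tA1; rewrite mxE; case: eqP => [->|_]; last by rewrite addr0.
    have [->|//] := eqVneq (A q j) 0; rewrite add0r mulNr oppr_ge0 oppr_eq0 => h1 h2.
    have : t * A p j = 0 by apply/eqP; rewrite eq_le h1 mulr_ge0 ?tn_entry.
    by move/eqP; rewrite (negPf h2).
  exists p, q; split=> //; left; exists t => //.
  apply/matrixP => i j; rewrite !mxE (negPf pq) addr0.
  by case: eqP => _; rewrite ?addr0 // mulNr subrK.
have Ap_row j : A p j = 0.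
  have [jc|jc|/val_inj->//] := ltngtP j cc; first exact: left.
  have hr : incr (fun i : 'I_2 => if i == ord0 then p else q).
    by move=> a b; case: eqP => [->|/eqP a0]; case: eqP => [->|/eqP b0] //=; rewrite ?qp //;
       move: a0; rewrite -val_eqE /=; have := ltn_ord a; have := ltn_ord b; lia.
  have hc : incr (fun i : 'I_2 => if i == ord0 then cc else j).
    by move=> a b; case: eqP => [->|/eqP a0]; case: eqP => [->|/eqP b0] //=;
       move: a0; rewrite -val_eqE /=; have := ltn_ord a; have := ltn_ord b; lia.
  (* The minor on rows [p], [q] and columns [cc], [j] reduces to [- A p j * A q cc], so [A p j]
     cannot be positive. *)
  have := sub_det_ge0 tA hr hc; rewrite /sub_det det2 !mxE /= Ap mul0r add0r oppr_ge0.
  rewrite pmulr_lle0 ?lt_neqAle ?(eq_sym 0) ?Aq ?tn_entry // => h.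
  by apply/eqP; rewrite eq_le h tn_entry.
exists (scalerow q 0 (addrow p q 1 A)); split.
- by apply: tn_scalerow => //; apply: tn_addrow.
(* The new matrix is [A] with rows [p] and [q] exchanged. *)
- have e i j : scalerow q 0 (addrow p q 1 A) (tperm p q i) j = A i j.
    rewrite !mxE; case: tpermP => [->|->|/eqP/negPf-> /eqP/negPf->].
    + by rewrite eqxx mul0r Ap_row.
    + by rewrite (negPf pq) eqxx Ap_row !mul1r add0r.
    + by rewrite addr0 mul1r.
  apply: (@ltn_support _ _ (tperm p q) q cc); rewrite ?e //.
  + exact: perm_inj.
  + move=> i j; rewrite e => Aij; split=> //.
    case: tpermP => [ei|->|] //; last by rewrite qp.
    by move: Aij; rewrite ei Ap_row eqxx.
  + by right; rewrite tpermR qp.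
- exists p, q; split=> //; right; apply/matrixP => i j; rewrite !mxE.
  have qp' : q == p = false by rewrite eq_sym (negPf pq).
  have [->|ip] := eqVneq i p; first by rewrite mul0r Ap_row.
  rewrite mul1r; have [->|iq] := eqVneq i q.
    by rewrite eqxx (negPf pq) mul0r add0r !mul1r Ap_row add0r.
  by rewrite !addr0 mul1r.
Qed.

End Descent.

(** * Building totally nonnegative matrices from the zero matrix *)

Section Generation.
Variables (R : realType) (n : nat).
Implicit Types (A : 'M[R]_n).

Lemma cone_plucker_addrow A (p q : 'I_n) t : adjacent p q -> 0 <= t ->
  diagram_cone (plucker_prod A) -> diagram_cone (plucker_prod (addrow p q t A)).
Proof.
move=> a t0; apply: (cone_plucker_move (u := lshift n p) (v := lshift n q) _ t0).
  by move: a; rewrite /adjacent.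
by move=> Z; apply: plucker_addrow.
Qed.

Lemma cone_plucker_addcol A (p q : 'I_n) t : adjacent p q -> 0 <= t ->
  diagram_cone (plucker_prod A) -> diagram_cone (plucker_prod (addcol p q t A)).
Proof.
move=> a t0; apply: (cone_plucker_move (u := rev_ord (lshift n q)) (v := rev_ord (lshift n p)) _ t0).
  by move: a; rewrite /adjacent /=; have := ltn_ord p; have := ltn_ord q; lia.
by move=> Z; apply: plucker_addcol.
Qed.

Lemma support_weight_tr A : support_weight A^T = support_weight A.
Proof.
rewrite /support_weight exchange_big; apply: eq_bigr => i _; apply: eq_bigr => j _.
by rewrite mxE; case: ifP => // _; lia.
Qed.

(** Drops when a diagonal entry is removed or moves down. *)
Definition diagonal_weight A : nat :=
  (\sum_i (if A i i != 0%R then n - i else 0))%N.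

End Generation.

(* The last nonzero entry is shifted down the diagonal until it can be        *)
(* removed from the corner.                                                   *)
Lemma cone_plucker_diagonal (R : realType) n (A : 'M[R]_n.+1) :
  (forall i j, i != j -> A i j = 0) -> (forall i, 0 <= A i i) ->
  diagram_cone (plucker_prod A).
Proof.
have [w] := ubnP (diagonal_weight A); elim: w A => // w IH A wA dA A0.
have [/existsP[k0 Ak0]|none] := boolP [exists i, A i i != 0]; last first.
  suff -> : A = 0 by exact: cone_plucker_zero.
  apply/matrixP => i j; rewrite mxE; have [->|ij] := eqVneq i j; last exact: dA.
  by apply/eqP; move: none; rewrite negb_exists => /forallP/(_ j); rewrite negbK.
case: (arg_maxnP (P := fun i => A i i != 0) (fun i : 'I_n.+1 => i : nat) Ak0) => k Ak maxk.
have [km|km] := eqVneq k ord_max.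
  pose B := addcorner (- A ord_max ord_max) A.
  have BE i j : B i j = if (i == ord_max) && (j == ord_max) then 0 else A i j.
    by rewrite mxE; case: ifP => [/andP[/eqP-> /eqP->]|_]; rewrite ?subrr ?addr0.
  have cB : diagram_cone (plucker_prod B).
    apply: IH => [|i j ij|i]; last by rewrite BE; case: ifP.
      suff: (diagonal_weight B < diagonal_weight A)%N by lia.
      rewrite /diagonal_weight.
      apply: (ltn_sum_one (i0 := k)) => [i|].
        by rewrite BE; case: (ifP (_ && _)) => _; rewrite ?eqxx.
      by rewrite BE Ak km !eqxx /= subSnn.
    by rewrite BE; case: ifP => // _; exact: dA.
  have am : adjacent (lshift n.+1 (ord_max : 'I_n.+1)) (rev_ord (lshift n.+1 (ord_max : 'I_n.+1))).
    by rewrite /adjacent /=; lia.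
  have -> : A = addcorner (A ord_max ord_max) B.
    apply/matrixP => i j; rewrite [RHS]mxE BE; case: ifP; rewrite ?add0r ?addr0 //.
    by case/andP => /eqP-> /eqP->.
  by apply: (cone_plucker_move am (A0 ord_max) _ cB) => Z; apply: plucker_addcorner.
have lm : (k.+1 < n.+1)%N by have := ltn_ord k; move: km; rewrite -val_eqE /=; lia.
pose l := Ordinal lm.
have kl : k != l by rewrite -val_eqE /=; lia.
have akl : adjacent k l by rewrite /adjacent eqxx.
have Al : A l l = 0.
  by apply/eqP; apply: contraTT isT => /maxk /=; rewrite ltnn.
have Arow j : A l j = 0.
  by have [<-|/dA//] := eqVneq l j.
have Acol i : A i l = 0.
  by have [->|/dA//] := eqVneq i l.
(* [B] has the entry at [k] shifted to [l]. Adding row and column [l] to row and column [k], and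
   scaling row and column [l] by 0, gives back [A]. *)
pose B : 'M[R]_n.+1 := \matrix_(i, j) A (tperm k l i) (tperm k l j).
have cB : diagram_cone (plucker_prod B).
  apply: IH => [|i j ij|i]; last by rewrite mxE.
    suff: (diagonal_weight B < diagonal_weight A)%N by lia.
    rewrite /diagonal_weight.
    rewrite (reindex_inj (@perm_inj _ (tperm k l))) /=.
    apply: (ltn_sum_one (i0 := k)) => [i|]; rewrite !mxE !tpermK.
      case: tpermP => [->|->|//]; last by rewrite Al eqxx.
      by case: ifP => //=; lia.
    by rewrite tpermL Ak /=; lia.
  by rewrite mxE dA // (inj_eq perm_inj).
suff -> : A = scalecol l 0 (addcol k l 1 (scalerow l 0 (addrow k l 1 B))).
  apply: cone_plucker_col; apply: cone_plucker_addcol => //.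
  by apply: cone_plucker_row; apply: cone_plucker_addrow.
apply/matrixP => i j; rewrite !mxE.
have lk : l == k = false by rewrite eq_sym (negPf kl).
have [->|jl] := eqVneq j l; first by rewrite mul0r Acol.
rewrite mul1r; have [->|il] := eqVneq i l.
  by rewrite !mul0r add0r Arow; case: ifP => _; rewrite ?mulr0.
have td x : x != k -> x != l -> tperm k l x = x by move=> *; rewrite tpermD // eq_sym.
have [->|ik] := eqVneq i k; have [->|jk] := eqVneq j k; rewrite ?(td i) ?(td j) //.
all: by rewrite ?tpermL ?tpermR ?Arow ?Acol; lra.
Qed.

(** Row steps clear the entries below the diagonal and, applied to the transpose, those above it.
    Each step lowers [support_weight] and is undone by operations preserving the cone; a diagonal
    matrix remains. *)
Lemma cone_plucker_tn (R : realType) n (A : 'M[R]_n.+1) : totally_nonnegative A ->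
  diagram_cone (plucker_prod A).
Proof.
have [w] := ubnP (support_weight A); elim: w A => // w IH A wA tA.
have [/existsP[i /existsP[j /andP[ij Aij]]]|nolow] :=
  boolP [exists i : 'I_n.+1, [exists j : 'I_n.+1, (j < i)%N && (A i j != 0)]].
  have [|A1 [tA1 wA1 [p [q [a eA]]]]] := row_step tA; first by exists i, j.
  have c1 : diagram_cone (plucker_prod A1) by apply: IH => //; lia.
  case: eA => [[t t0 ->]|->]; first exact: cone_plucker_addrow.
  by apply: cone_plucker_row; apply: cone_plucker_addrow.
have [/existsP[i /existsP[j /andP[ij Aij]]]|noup] :=
  boolP [exists i : 'I_n.+1, [exists j : 'I_n.+1, (i < j)%N && (A i j != 0)]].
  have [|A1 [tA1 wA1 [p [q [a eA]]]]] := row_step (tn_tr tA).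
    by exists j, i; rewrite mxE.
  have c1 : diagram_cone (plucker_prod A1^T).
    apply: IH; last exact: tn_tr.
    by rewrite support_weight_tr; rewrite support_weight_tr in wA1; lia.
  rewrite -[A]trmxK; case: eA => [[t t0 ->]|->].
    by rewrite -{1}[A1]trmxK; exact: cone_plucker_addcol.
  rewrite -{1}[addrow _ _ _ _]trmxK; apply: cone_plucker_col.
  by rewrite -{1}[A1]trmxK; exact: cone_plucker_addcol.
apply: cone_plucker_diagonal => [i j ij|i]; last exact: tn_entry.
apply/eqP; have [lt|gt|/val_inj e] := ltngtP i j.
- move: noup; rewrite negb_exists => /forallP/(_ i).
  by rewrite negb_exists => /forallP/(_ j); rewrite lt /= negbK.
- move: nolow; rewrite negb_exists => /forallP/(_ i).
  by rewrite negb_exists => /forallP/(_ j); rewrite gt /= negbK.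
- by rewrite e eqxx in ij.
Qed.

(** * The equivalences assembled *)

Section Conclusion.
Variables (R : realType) (n : nat).

Lemma height_dominance_plucker_dom (X Y : {set 'I_(n.+1 + n.+1)} * {set 'I_(n.+1 + n.+1)}) :
  balanced X -> balanced Y -> height_dominance X Y -> plucker_dom R X Y.
Proof.
move=> bX bY h; split=> // A /cone_plucker_tn c.
exact: cone_dominance c h.
Qed.

End Conclusion.

Lemma minor_ineq_height (R : realType) n (P1 P2 Q1 Q2 I1 I2 J1 J2 : {set 'I_n})
    (eP1 : #|P1| = #|Q1|) (eP2 : #|P2| = #|Q2|)
    (eI1 : #|I1| = #|J1|) (eI2 : #|I2| = #|J2|) : (0 < n)%N ->
  minor_ineq R eP1 eP2 eI1 eI2 <->
  height_dominance (crossed P1 P2 Q1 Q2) (crossed I1 I2 J1 J2).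
Proof.
case: n P1 P2 Q1 Q2 I1 I2 J1 J2 eP1 eP2 eI1 eI2 => // n P1 P2 Q1 Q2 I1 I2 J1 J2.
move=> eP1 eP2 eI1 eI2 _; rewrite -height_dominance_uncrossed.
have cU (P Q : {set 'I_n.+1}) : #|P| = #|Q| -> #|join_rev P (~: Q)| = n.+1.
  by move=> e; rewrite card_join_rev e cardsC card_ord.
have bX : balanced (uncrossed P1 P2 Q1 Q2) by split; apply: cU.
have bY : balanced (uncrossed I1 I2 J1 J2) by split; apply: cU.
have e A : plucker_prod A (uncrossed P1 P2 Q1 Q2) = minor A eP1 * minor A eP2 :> R.
  by rewrite /plucker_prod !plucker_join -!set_minorE.
have e' A : plucker_prod A (uncrossed I1 I2 J1 J2) = minor A eI1 * minor A eI2 :> R.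
  by rewrite /plucker_prod !plucker_join -!set_minorE.
split=> [h|/(height_dominance_plucker_dom R bX bY)[_ _ h] A tA].
  by apply: (@plucker_dom_height R); split=> // A tA; rewrite e e'; exact: h.
by rewrite -e -e'; exact: h.
Qed.

Lemma principal_minor_ineq_height (R : realType) m (R1 R2 K1 K2 : {set 'I_m}) :
  (0 < m)%N ->
  principal_minor_ineq R R1 R2 K1 K2 <-> height_dominance (R1, R2) (K1, K2).
Proof.
move=> m0; rewrite -height_dominance_doubled.
exact: (minor_ineq_height R (erefl #|R1|) (erefl #|R2|) (erefl #|K1|) (erefl #|K2|) m0).
Qed.

Theorem theoremI (R : realType) (n : nat) (hn : (1 <= n)%N)
    (P1 P2 Q1 Q2 I1 I2 J1 J2 : {set 'I_n})
    (hP1 : P1 <> set0) (hP2 : P2 <> set0)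
    (hQ1 : Q1 <> set0) (hQ2 : Q2 <> set0)
    (hI1 : I1 <> set0) (hI2 : I2 <> set0)
    (hJ1 : J1 <> set0) (hJ2 : J2 <> set0)
    (eP1 : #|P1| = #|Q1|) (eP2 : #|P2| = #|Q2|)
    (eI1 : #|I1| = #|J1|) (eI2 : #|I2| = #|J2|)
    (hP : (#|P1| + #|P2|)%N = n) (hI : (#|I1| + #|I2|)%N = n) :
  let R1 := join_rev P1 Q2 in
  let R2 := join_rev P2 Q1 in
  let K1 := join_rev I1 J2 in
  let K2 := join_rev I2 J1 in
  (set_op_dominance R1 R2 K1 K2 <-> minor_ineq R eP1 eP2 eI1 eI2) /\
  (set_op_dominance R1 R2 K1 K2 <-> principal_minor_ineq R R1 R2 K1 K2) /\
  (set_op_dominance R1 R2 K1 K2 <-> even_contiguous_dominance R1 R2 K1 K2).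
Proof.
move=> R1 R2 K1 K2.
have h4 := set_op_dominance_height (R1, R2) (K1, K2).
have h3 := even_contiguous_dominance_height (R1, R2) (K1, K2).
have h1 := minor_ineq_height R eP1 eP2 eI1 eI2 hn.
have h2 : principal_minor_ineq R R1 R2 K1 K2 <-> _ :=
  principal_minor_ineq_height R R1 R2 K1 K2 (leq_trans hn (leq_addr n n)).
rewrite /= -/R1 -/R2 -/K1 -/K2 in h4 h3; rewrite /crossed -/R1 -/R2 -/K1 -/K2 in h1.
by split; [rewrite h4 h1|split; [rewrite h4 h2|rewrite h4 h3]].
Qed.
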